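(* Let $A$ be an integrally closed domain, let $a,b\in A$ be nonzero elements, and let $B=A[a/b]$ (a subring of the quotient field of $A$). Then $H_1(A,B,B)=0$ if and only if $a^2A\cap b^2A=(aA\cap bA)^2$. In particular, if $aA\cap bA$ is a flat ideal of $A$ (that is, flat as an $A$-module), then $H_1(A,B,B)=0$.
   Context: All rings are commutative with unit. For a ring morphism $A\to B$ and a $B$-module $E$, $H_n(A,B,E)$ denotes the $n$-th André-Quillen homology module. *)

(* Defs.v *)
From HB Require Import structures.
From mathcomp Require Import all_boot all_order all_algebra.
From mathcomp Require Import boolp classical_sets.
From mathcomp Require Import finmap.
From mathcomp.multinomials Require Import monalg.

Set Implicit Arguments.
Unset Strict Implicit.
Unset Printing Implicit Defensive.

Import GRing.Theory.

Local Open Scope ring_scope.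
Local Open Scope quotient_scope.
Local Open Scope classical_set_scope.

Section Span.
Variables (R : nzRingType) (V : lmodType R) (S : set V).

Inductive in_span : V -> Prop :=
| in_span0 : in_span 0
| in_spanZD c u v : S u -> in_span v -> in_span (c *: u + v).

Lemma in_span_sub u : S u -> in_span u.
Proof. by move=> Su; rewrite -[u]addr0 -[u]scale1r; apply: in_spanZD in_span0. Qed.

Lemma in_spanD u v : in_span u -> in_span v -> in_span (u + v).
Proof.
by move=> + v_in; elim=> [|c x y Sx _ IH]; rewrite ?add0r // -addrA; exact: in_spanZD.
Qed.

Lemma in_spanZ c u : in_span u -> in_span (c *: u).
Proof.
elim=> [|d x y Sx _ IH]; first by rewrite scaler0; exact: in_span0.
by rewrite scalerDr scalerA; exact: in_spanZD.
Qed.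

Definition span_pred : {pred V} := fun v => `[< in_span v >].

Lemma span_predP v : reflect (in_span v) (v \in span_pred).
Proof. exact: asboolP. Qed.

Lemma span_submod_closed : submod_closed span_pred.
Proof.
split=> [|c u v /span_predP Hu /span_predP Hv]; apply/span_predP.
  exact: in_span0.
exact: in_spanD (in_spanZ c Hu) Hv.
Qed.

HB.instance Definition _ := GRing.isSubmodClosed.Build R V span_pred span_submod_closed.
End Span.

(** [quotmod S] is the quotient of [V] by the submodule spanned by [S]. *)
Definition quotmod (R : nzRingType) (V : lmodType R) (S : set V) : Type :=
  Quotient.quot (span_pred S).

Section QuotMod.
Variables (R : nzRingType) (V : lmodType R) (S : set V).
Local Notation Q := (Quotient.quot (span_pred S)).

HB.instance Definition _ := GRing.Zmodule.on (quotmod S).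

Definition quot_pi (v : V) : quotmod S := \pi_Q v.
Definition quot_repr (x : quotmod S) : V := repr (x : Q).

Lemma quot_reprK x : quot_pi (quot_repr x) = x.
Proof. exact: reprK. Qed.

Lemma quot_pi_eq u v : quot_pi u = quot_pi v <-> in_span S (u - v).
Proof.
split=> [/eqP|/span_predP].
  by rewrite /quot_pi -Quotient.idealrBE => /span_predP.
by rewrite Quotient.idealrBE => /eqP.
Qed.

Lemma quot_pi_is_zmod_morphism : zmod_morphism quot_pi.
Proof. by move=> u v; rewrite /quot_pi Quotient.pi_add Quotient.pi_opp. Qed.

HB.instance Definition _ :=
  GRing.isZmodMorphism.Build V (quotmod S) quot_pi quot_pi_is_zmod_morphism.

Definition quot_scale c (x : quotmod S) := quot_pi (c *: quot_repr x).

Lemma quot_scaleE c v : quot_scale c (quot_pi v) = quot_pi (c *: v).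
Proof.
apply/quot_pi_eq; rewrite -scalerBr; apply: in_spanZ.
by apply/quot_pi_eq; rewrite quot_reprK.
Qed.

Lemma quot_scaleA a b x : quot_scale a (quot_scale b x) = quot_scale (a * b) x.
Proof. by rewrite -[x]quot_reprK !quot_scaleE scalerA. Qed.

Lemma quot_scale1 : left_id 1 quot_scale.
Proof. by move=> x; rewrite -[x]quot_reprK quot_scaleE scale1r. Qed.

Lemma quot_scaleDr : right_distributive quot_scale +%R.
Proof.
move=> c x y; rewrite -[x]quot_reprK -[y]quot_reprK -raddfD !quot_scaleE.
by rewrite scalerDr raddfD.
Qed.

Lemma quot_scaleDl x : {morph quot_scale^~ x : a b / a + b}.
Proof. by move=> a b; rewrite -[x]quot_reprK !quot_scaleE scalerDl raddfD. Qed.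

HB.instance Definition _ := GRing.Zmodule_isLmodule.Build R (quotmod S)
  quot_scaleA quot_scale1 quot_scaleDr quot_scaleDl.

Lemma quot_pi_is_scalable : scalable quot_pi.
Proof. by move=> c v; rewrite -quot_scaleE. Qed.

HB.instance Definition _ :=
  GRing.isScalable.Build R V (quotmod S) *:%R quot_pi quot_pi_is_scalable.

Section Lift.
Variables (W : lmodType R) (f : {linear V -> W}).
Hypothesis fS : forall v, S v -> f v = 0.

Definition quot_lift of (forall v, S v -> f v = 0) :=
  fun x : quotmod S => f (quot_repr x).
Local Notation lift := (quot_lift fS).

Lemma quot_liftE v : lift (quot_pi v) = f v.
Proof.
have f0 w : in_span S w -> f w = 0.
  by elim=> [|c u {}w Su _ IH]; rewrite ?raddf0 // linearP fS // IH scaler0 addr0.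
apply/eqP; rewrite -subr_eq0 -[X in X - _]/(f _) -raddfB; apply/eqP/f0.
by apply/quot_pi_eq; rewrite quot_reprK.
Qed.

Lemma quot_lift_is_linear : linear lift.
Proof.
move=> c x y; rewrite -[x]quot_reprK -[y]quot_reprK -linearP !quot_liftE.
exact: linearP.
Qed.

HB.instance Definition _ :=
  GRing.isLinear.Build R (quotmod S) W *:%R lift quot_lift_is_linear.
End Lift.
End QuotMod.

(** The linear map from the free module on [K] determined by [h]. *)
Section FreeLift.
Variables (R : nzRingType) (K : choiceType) (W : lmodType R) (h : K -> W).

Definition free_lift (g : {malg R[K]}) : W := \sum_(k <- msupp g) g@_k *: h k.

Lemma free_liftEw (d : {fset K}) g : (msupp g `<=` d)%fset ->
  free_lift g = \sum_(k <- d) g@_k *: h k.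
Proof.
move=> le_gd; rewrite /free_lift (big_fset_incl _ le_gd) // => k _ k_notin.
by rewrite mcoeff_outdom // scale0r.
Qed.

Lemma free_lift_is_linear : linear free_lift.
Proof.
move=> c u v; pose d := (msupp u `|` msupp v)%fset.
have le_u : (msupp u `<=` d)%fset by exact: fsubsetUl.
have le_v : (msupp v `<=` d)%fset by exact: fsubsetUr.
have le_cuv : (msupp (c *: u + v) `<=` d)%fset.
  apply: fsubset_trans (msuppD_le _ _) _.
  by rewrite fsubUset le_v andbT (fsubset_trans (msuppZ_le _ _)).
rewrite (free_liftEw le_u) (free_liftEw le_v) (free_liftEw le_cuv).
rewrite scaler_sumr -big_split /=; apply: eq_bigr => k _.
by rewrite mcoeffD mcoeffZ scalerDl scalerA.
Qed.

HB.instance Definition _ :=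
  GRing.isLinear.Build R {malg R[K]} W *:%R free_lift free_lift_is_linear.

Lemma free_liftU k : free_lift << k >> = h k.
Proof. by rewrite (free_liftEw msuppU_le) big_seq_fset1 mcoeffUU scale1r. Qed.
End FreeLift.

Section Tensor.
Variable R : comNzRingType.

Section Def.
Variables M N : lmodType R.
Local Notation "m *t n" := (<< ((m, n) : (M * N)%type) >> : {malg R[(M * N)%type]})
  (at level 40, no associativity).

Definition tensor_rel : set {malg R[(M * N)%type]} := fun z =>
  (exists c m m' n, z = (c *: m + m') *t n - (c *: (m *t n) + m' *t n)) \/
  (exists c m n n', z = m *t (c *: n + n') - (c *: (m *t n) + m *t n')).

Definition tensor := quotmod tensor_rel.
HB.instance Definition _ := GRing.Lmodule.on tensor.
Definition tens (m : M) (n : N) : tensor := quot_pi tensor_rel (m *t n).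

Lemma tensPl c m m' n : tens (c *: m + m') n = c *: tens m n + tens m' n.
Proof.
rewrite /tens -linearZ -raddfD; apply/quot_pi_eq/in_span_sub; left.
by exists c, m, m', n.
Qed.

Lemma tensPr c m n n' : tens m (c *: n + n') = c *: tens m n + tens m n'.
Proof.
rewrite /tens -linearZ -raddfD; apply/quot_pi_eq/in_span_sub; right.
by exists c, m, n, n'.
Qed.
End Def.

(** [f] tensored with the identity of [M]. *)
Section Map.
Variables (M N N' : lmodType R) (f : {linear N -> N'}).

Let h (k : N * M) : tensor N' M := tens (f k.1) k.2.

Lemma tensor_mapl_rel z : tensor_rel z -> free_lift h z = 0.
Proof.
case=> -[c [m [m' [n ->]]]]; rewrite raddfB raddfD /= linearZ /= !free_liftU /h /=.
  by rewrite linearP tensPl subrr.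
by rewrite tensPr subrr.
Qed.

Definition tensor_mapl : tensor N M -> tensor N' M := quot_lift tensor_mapl_rel.
HB.instance Definition _ := GRing.Linear.on tensor_mapl.
End Map.

Definition flat (M : lmodType R) : Prop :=
  forall (N N' : lmodType R) (f : {linear N -> N'}),
    injective f -> injective (tensor_mapl (M := M) f).
End Tensor.

(** The polynomial ring over [A] with one variable for each element of [X]. *)
Definition polyring (A : comNzRingType) (X : choiceType) : comNzRingType :=
  {malg A[{cmonom X}]}.

Definition polyconst (A : comNzRingType) (X : choiceType) : {rmorphism A -> polyring A X} :=
  @malgC {cmonom X} A.

Definition polyvar (A : comNzRingType) (X : choiceType) (x : X) : polyring A X :=
  << ucm x >>.

Section PolyEval.
Variables (A S : comNzRingType) (X : choiceType) (f : {rmorphism A -> S}) (u : X -> S).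

Definition monom_eval (m : {cmonom X}) : S := \prod_(x <- finsupp m) u x ^+ m x.

Lemma monom_evalEw (d : {fset X}) (m : {cmonom X}) : (finsupp m `<=` d)%fset ->
  monom_eval m = \prod_(x <- d) u x ^+ m x.
Proof.
move=> le_md; rewrite /monom_eval (big_fset_incl _ le_md) // => x _ x_notin.
by move: x_notin; rewrite -cmE_eq0 => /eqP->; rewrite expr0.
Qed.

Lemma monom_eval_is_mmorphism : mmorphism monom_eval.
Proof.
split=> [m n|]; last by rewrite /monom_eval mdom1 big_seq_fset0.
have le_m : (finsupp m `<=` finsupp m `|` finsupp n)%fset by exact: fsubsetUl.
have le_n : (finsupp n `<=` finsupp m `|` finsupp n)%fset by exact: fsubsetUr.
rewrite (monom_evalEw le_m) (monom_evalEw le_n) {1}/monom_eval mdomD -big_split /=.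
by apply: eq_bigr => x _; rewrite cmM exprD.
Qed.

HB.instance Definition _ :=
  isMultiplicative.Build {cmonom X} S monom_eval monom_eval_is_mmorphism.

(** The ring morphism on [polyring A X] that restricts to [f] on [A] and sends
    the variable [x] to [u x]. *)
Definition polyeval : {rmorphism polyring A X -> S} := mmap f monom_eval.

Lemma polyevalC a : polyeval (polyconst A X a) = f a.
Proof. exact: mmapC. Qed.

Lemma polyeval_var x : polyeval (polyvar A x) = u x.
Proof.
by rewrite /polyeval /= mmapU /= (rmorph1 f) mul1r /monom_eval mdomU big_seq_fset1 cmUU expr1.
Qed.
End PolyEval.

Lemma polyring_ext (A S : comNzRingType) (X : choiceType)
    (g h : {rmorphism polyring A X -> S}) :
  (forall a, g (polyconst A X a) = h (polyconst A X a)) ->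
  (forall x, g (polyvar A x) = h (polyvar A x)) -> g =1 h.
Proof.
move=> eqC eqV.
have mulU (m m' : {cmonom X}) : << mmul m m' >> = << m >> * << m' >> :> polyring A X.
  by rewrite malgM_def fgmulUU mulr1.
have eqM (m : {cmonom X}) : g << m >> = h << m >>.
  have [k] := ubnP (mdeg m); elim: k m => // k IH m lt_mk.
  have [->|m_neq1] := eqVneq m mone; first by rewrite !rmorph1.
  have /fset0Pn [x xm] : finsupp m != fset0.
    apply: contra m_neq1 => /eqP m0; apply/eqP/eqP/cmP => x.
    by rewrite cm1; apply/eqP; rewrite cmE_eq0 m0 inE.
  have [m' def_m] : exists m', m = mmul (ucm x) m'.
    exists (divcm m (ucm x)); apply/eqP/cmP => y; rewrite cmM divcmE cmU subnKC //.
    by case: eqP => // <-; rewrite lt0n cmE_neq0.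
  move: lt_mk; rewrite def_m mdegM mdegU mulU => lt_mk.
  have eqVx : g << ucm x >> = h << ucm x >> := eqV x.
  have eqm' : g << m' >> = h << m' >> by apply: IH.
  rewrite (rmorphM g << ucm x >> << m' >>).
  rewrite (rmorphM h << ucm x >> << m' >>).
  exact: (congr2 *%R eqVx eqm').
move=> p; rewrite [p]monalgE !raddf_sum; apply: eq_bigr => m _.
have -> : << p@_m *g m >> = malgC p@_m * << m >> :> polyring A X.
  by rewrite malgM_def fgmulUU mulr1 mul1m.
have gM := rmorphM g (malgC p@_m) << m >>.
have hM := rmorphM h (malgC p@_m) << m >>.
apply: etrans gM (etrans _ (esym hM)).
exact: (congr2 *%R (eqC _) (eqM m)).
Qed.

Section Resolution.
Variables (A B : comNzRingType) (f : {rmorphism A -> B}).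

(** The standard free simplicial resolution of the [A]-algebra [B], for the
    comonad that sends an [A]-algebra to the polynomial algebra on its set of
    elements (André-Quillen homology does not depend on the resolution): its ring of
    [n]-simplices is [P_n = aqres n.+1], where [aqres 0 = B] and [aqres n.+1]
    is the polynomial [A]-algebra on the set underlying [aqres n]. *)
Fixpoint aqres (n : nat) : comNzRingType :=
  if n is m.+1 then polyring A (aqres m) else B.

Definition aqvar (n : nat) (x : aqres n) : aqres n.+1 := polyvar A x.

Definition aqstr (n : nat) : {rmorphism A -> aqres n} :=
  if n is m.+1 return {rmorphism A -> aqres n} then polyconst A (aqres m) else f.

Definition aqcounit (n : nat) : {rmorphism aqres n.+1 -> aqres n} :=
  polyeval (aqstr n) id.

(** The [i]-th face [aqres n.+1 -> aqres n], for [i <= n] (the value for [i > n]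
    is junk): the [0]-th one is the counit, and the [i.+1]-st one is the
    substitution of variables along the [i]-th face in the previous degree. *)
Fixpoint aqface (n i : nat) {struct i} : {rmorphism aqres n.+1 -> aqres n} :=
  if i is j.+1 then
    match n return {rmorphism aqres n.+1 -> aqres n} with
    | m.+1 => polyeval (aqstr m.+1) (fun x => aqvar (aqface m j x))
    | 0 => aqcounit 0
    end
  else aqcounit n.

Fixpoint aqaug (n : nat) : {rmorphism aqres n -> B} :=
  if n is m.+1 return {rmorphism aqres n -> B}
  then aqaug m \o aqface m 0 else idfun.

Lemma aqres_ext n (S : comNzRingType) (g h : {rmorphism aqres n.+1 -> S}) :
  (forall a, g (aqstr n.+1 a) = h (aqstr n.+1 a)) ->
  (forall x, g (aqvar x) = h (aqvar x)) -> g =1 h.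
Proof. exact: polyring_ext. Qed.

Lemma aqface_str n i a : aqface n i (aqstr n.+1 a) = aqstr n a.
Proof. by case: i n => [|i] [|n]; exact: polyevalC. Qed.

Lemma aqface0_var n (x : aqres n) : aqface n 0 (aqvar x) = x.
Proof. exact: polyeval_var. Qed.

Lemma aqfaceS_var n i (x : aqres n.+1) :
  aqface n.+1 i.+1 (aqvar x) = aqvar (aqface n i x).
Proof. exact: polyeval_var. Qed.

Lemma aqaugS n (p : aqres n.+1) : aqaug n.+1 p = aqaug n (aqface n 0 p).
Proof. by []. Qed.

Lemma aqface_face0 n j p :
  aqface n 0 (aqface n.+1 j.+1 p) = aqface n j (aqface n.+1 0 p).
Proof.
pose g : {rmorphism aqres n.+2 -> aqres n} := aqface n 0 \o aqface n.+1 j.+1.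
pose h : {rmorphism aqres n.+2 -> aqres n} := aqface n j \o aqface n.+1 0.
apply: (aqres_ext (g := g) (h := h)) => [a|x].
  apply: etrans (congr1 (aqface n 0) (aqface_str n.+1 j.+1 a)) _.
  apply: etrans (aqface_str n 0 a) _; apply: esym.
  exact: etrans (congr1 (aqface n j) (aqface_str n.+1 0 a)) (aqface_str n j a).
apply: etrans (congr1 (aqface n 0) (aqfaceS_var j x)) _.
apply: etrans (aqface0_var (aqface n j x)) _; apply: esym.
exact: (congr1 (aqface n j) (aqface0_var x)).
Qed.

Lemma aqface_face n i j p : (i <= j <= n)%N ->
  aqface n i (aqface n.+1 j.+1 p) = aqface n j (aqface n.+1 i p).
Proof.
elim: i n j p => [|i IH] n j p.
  move=> _; exact (aqface_face0 j p).
case: j p => [|j] p; first (move=> ij; exfalso; by case/andP: ij).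
case: n p => [|n] p; first (move=> ij; exfalso; by case/andP: ij).
move=> ij.
pose g : {rmorphism aqres n.+3 -> aqres n.+1} := aqface n.+1 i.+1 \o aqface n.+2 j.+2.
pose h : {rmorphism aqres n.+3 -> aqres n.+1} := aqface n.+1 j.+1 \o aqface n.+2 i.+1.
apply: (aqres_ext (g := g) (h := h)) => [a|x].
  apply: etrans (congr1 (aqface n.+1 i.+1) (aqface_str n.+2 j.+2 a)) _.
  apply: etrans (aqface_str n.+1 i.+1 a) _; apply: esym.
  apply: etrans (congr1 (aqface n.+1 j.+1) (aqface_str n.+2 i.+1 a)) _.
  exact: aqface_str.
apply: etrans (congr1 (aqface n.+1 i.+1) (aqfaceS_var j.+1 x)) _.
apply: etrans (aqfaceS_var i (aqface n.+1 j.+1 x)) _; apply: esym.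
apply: etrans (congr1 (aqface n.+1 j.+1) (aqfaceS_var i x)) _.
apply: etrans (aqfaceS_var j (aqface n.+1 i x)) _.
exact: (congr1 (@aqvar n) (esym (IH n j x ij))).
Qed.

Lemma aqaug_face n i p : aqaug n (aqface n i p) = aqaug n.+1 p.
Proof.
elim: n i p => [|n IH] [|i] p.
      exact (esym (aqaugS p)).
    exact (esym (aqaugS p)).
  exact (esym (aqaugS p)).
refine (etrans (aqaugS (aqface n.+1 i.+1 p)) _).
refine (etrans (congr1 (aqaug n) (aqface_face0 i p)) _).
exact (etrans (IH i (aqface n.+1 0 p)) (esym (aqaugS p))).
Qed.

Lemma aqaug_str n a : aqaug n (aqstr n a) = f a.
Proof.
elim: n => [|n IH]; first by [].
refine (etrans (aqaugS (aqstr n.+1 a)) _).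
exact (etrans (congr1 (aqaug n) (aqface_str n 0 a)) IH).
Qed.

End Resolution.

(** [diffmod s g E] is the [B]-module of differentials of the [A]-algebra [P]
    tensored over [P] with the [B]-module [E], where [P] acts through [g]. It is
    generated by the symbols [e (x) dp], written [p dx e] below; [B]-linear maps
    from it to [W] are the [A]-derivations from [P] to [Hom_B(E, W)]. *)
Section Differentials.
Variables (A B P : comNzRingType) (s : {rmorphism A -> P}) (g : {rmorphism P -> B}).
Variable E : lmodType B.
Local Notation "p 'dx' e" := (<< ((p, e) : (P * E)%type) >> : {malg B[(P * E)%type]})
  (at level 40, no associativity).

Definition diff_rel : set {malg B[(P * E)%type]} := fun z =>
  [\/ exists c p e e', z = p dx (c *: e + e') - (c *: (p dx e) + p dx e'),
      exists p q e, z = (p + q) dx e - (p dx e + q dx e),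
      exists p q e, z = (p * q) dx e - (p dx (g q *: e) + q dx (g p *: e))
    | exists a e, z = s a dx e].

Definition diffmod := quotmod diff_rel.
HB.instance Definition _ := GRing.Lmodule.on diffmod.
Definition dsym (p : P) (e : E) : diffmod := quot_pi diff_rel (p dx e).

Lemma diffP p c e e' : dsym p (c *: e + e') = c *: dsym p e + dsym p e'.
Proof.
rewrite /dsym -linearP; apply/quot_pi_eq/in_span_sub.
by apply: Or41; exists c, p, e, e'.
Qed.

Lemma diffD p q e : dsym (p + q) e = dsym p e + dsym q e.
Proof.
rewrite /dsym -raddfD; apply/quot_pi_eq/in_span_sub.
by apply: Or42; exists p, q, e.
Qed.

Lemma diffM p q e : dsym (p * q) e = dsym p (g q *: e) + dsym q (g p *: e).
Proof.
rewrite /dsym -raddfD; apply/quot_pi_eq/in_span_sub.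
by apply: Or43; exists p, q, e.
Qed.

Lemma diffC a e : dsym (s a) e = 0.
Proof.
rewrite /dsym -(raddf0 (quot_pi diff_rel)); apply/quot_pi_eq/in_span_sub.
by rewrite subr0; apply: Or44; exists a, e.
Qed.

Lemma diffmod_ext (W : lmodType B) (u v : {linear diffmod -> W}) :
  (forall p e, u (dsym p e) = v (dsym p e)) -> u =1 v.
Proof.
move=> eq_uv x; rewrite -[x]quot_reprK [quot_repr x]monalgE !raddf_sum.
apply: eq_bigr => -[p e] _; set c := _@__.
have -> : << c *g (p, e) >> = c *: << (p, e) >> :> {malg B[(P * E)%type]}.
  by apply/malgP => k; rewrite mcoeffZ !mcoeffU mulr_natr.
have piZ : quot_pi diff_rel (c *: << (p, e) >>) = c *: dsym p e by rewrite /dsym -linearZ.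
have uZ := linearZ_LR u c (dsym p e); have vZ := linearZ_LR v c (dsym p e).
refine (etrans (congr1 u piZ) (etrans uZ _)); apply: esym.
refine (etrans (congr1 v piZ) (etrans vZ _)).
exact (congr1 (GRing.scale c) (esym (eq_uv p e))).
Qed.
End Differentials.

Section DiffMap.
Variables (A B P P' : comNzRingType) (s : {rmorphism A -> P}) (s' : {rmorphism A -> P'}).
Variables (g : {rmorphism P -> B}) (g' : {rmorphism P' -> B}) (E : lmodType B).
Variable h : {rmorphism P -> P'}.
Hypotheses (hs : forall a, h (s a) = s' a) (hg : forall p, g' (h p) = g p).

Let gen (k : (P * E)%type) : diffmod s' g' E := dsym s' g' (h k.1) k.2.

Lemma diff_map_rel z : diff_rel s g z -> free_lift gen z = 0.
Proof.
case=> [[c [p [e [e' ->]]]]|[p [q [e ->]]]|[p [q [e ->]]]|[a [e ->]]].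
- by rewrite raddfB raddfD /= linearZ /= !free_liftU /gen /= diffP subrr.
- by rewrite raddfB raddfD /= !free_liftU /gen /= rmorphD diffD subrr.
- by rewrite raddfB raddfD /= !free_liftU /gen /= rmorphM diffM !hg subrr.
- by rewrite free_liftU /gen /= hs diffC.
Qed.

(** The map sending [e (x) dp] to [e (x) d(h p)]. *)
Definition diff_map : diffmod s g E -> diffmod s' g' E := quot_lift diff_map_rel.
HB.instance Definition _ := GRing.Linear.on diff_map.

Lemma diff_mapE p e : diff_map (dsym s g p e) = dsym s' g' (h p) e.
Proof. exact: etrans (quot_liftE _ _) (free_liftU _ _). Qed.
End DiffMap.

Lemma alternating_sum (V : zmodType) (a : nat -> nat -> V) m :
  (forall i j, (i <= j < m)%N -> a i j.+1 = - a j i) ->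
  \sum_(i < m) \sum_(j < m.+1) a i j = 0.
Proof.
elim: m => [|m IH] aN; first by rewrite big_ord0.
rewrite big_ord_recr /=.
under eq_bigr => i _ do rewrite big_ord_recr /=.
rewrite big_split /= IH => [|i j /andP[ij jm]]; last by rewrite aN // ij ltnS ltnW.
rewrite add0r [X in _ + X]big_ord_recr /=.
transitivity (\sum_(i < m.+1) (a i m.+1 + a m i)).
  by rewrite big_split /= [in RHS]big_ord_recr /= addrA addrAC.
by rewrite big1 // => i _; rewrite aN ?addNr // -ltnS ltn_ord ltnSn.
Qed.

Section Homology.
Variables (A B : comNzRingType) (f : {rmorphism A -> B}) (E : lmodType B).

Definition aqchain (n : nat) := diffmod (aqstr f n.+1) (aqaug f n.+1) E.
HB.instance Definition _ n := GRing.Lmodule.on (aqchain n).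

Definition aqchain_face (n i : nat) : aqchain n.+1 -> aqchain n :=
  diff_map (E := E) (aqface_str f n.+1 i) (@aqaug_face A B f n.+1 i).
HB.instance Definition _ n i := GRing.Linear.on (@aqchain_face n i).

Definition aqbd (n : nat) (x : aqchain n.+1) : aqchain n :=
  \sum_(i < n.+2) (-1) ^+ i *: @aqchain_face n i x.

Lemma aqbd_is_linear n : linear (@aqbd n).
Proof.
move=> c x y; rewrite /aqbd scaler_sumr -big_split /=; apply: eq_bigr => i _.
by rewrite linearP scalerDr !scalerA mulrC.
Qed.

HB.instance Definition _ n :=
  GRing.isLinear.Build B (aqchain n.+1) (aqchain n) *:%R (@aqbd n) (@aqbd_is_linear n).

Lemma aqchain_faceE n i p e :
  @aqchain_face n i (dsym (aqstr f n.+2) (aqaug f n.+2) p e) =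
  dsym (aqstr f n.+1) (aqaug f n.+1) (aqface f n.+1 i p) e.
Proof. exact: diff_mapE. Qed.

Lemma aqchain_face_face n i j (x : aqchain n.+2) : (i <= j <= n.+1)%N ->
  aqchain_face i (aqchain_face j.+1 x) = aqchain_face j (aqchain_face i x).
Proof.
move=> ij.
pose u : {linear aqchain n.+2 -> aqchain n} :=
  @aqchain_face n i \o @aqchain_face n.+1 j.+1.
pose v : {linear aqchain n.+2 -> aqchain n} :=
  @aqchain_face n j \o @aqchain_face n.+1 i.
apply: (diffmod_ext (u := u) (v := v)) => p e.
refine (etrans (congr1 (@aqchain_face n i) (aqchain_faceE j.+1 p e)) _).
refine (etrans (aqchain_faceE i (aqface f n.+2 j.+1 p) e) _).
apply: esym.
refine (etrans (congr1 (@aqchain_face n j) (aqchain_faceE i p e)) _).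
refine (etrans (aqchain_faceE j (aqface f n.+2 i p) e) _).
congr (dsym _ _ _ e).
exact (esym (@aqface_face A B f n.+1 i j p ij)).
Qed.

Lemma aqbd_bd n (x : aqchain n.+2) : aqbd (aqbd x) = 0.
Proof.
pose F i j := @aqchain_face n i (@aqchain_face n.+1 j x).
have -> : aqbd (aqbd x) = \sum_(i < n.+2) \sum_(j < n.+3) (-1) ^+ (i + j) *: F i j.
  rewrite {1}/aqbd; apply: eq_bigr => i _.
  rewrite /aqbd (raddf_sum (@aqchain_face n i)) scaler_sumr; apply: eq_bigr => j _.
  rewrite exprD -scalerA; congr (_ *: _).
  exact: (linearZ_LR (@aqchain_face n i)).
apply: (@alternating_sum _ (fun i j => (-1) ^+ (i + j) *: F i j)) => i j /andP[ij jn].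
have -> : F i j.+1 = F j i by apply: aqchain_face_face; rewrite ij.
by rewrite addnS exprS mulN1r scaleNr addnC.
Qed.

Definition aqcycle (n : nat) : {pred aqchain n} :=
  match n return {pred aqchain n} with
  | 0 => predT
  | m.+1 => fun z => aqbd z == 0
  end.

Lemma aqcycle_submod_closed n : submod_closed (@aqcycle n).
Proof.
case: n => [|n]; first by split.
have cycleE (z : aqchain n.+1) : (z \in @aqcycle n.+1) = (aqbd z == 0) by [].
split=> [|c u v]; rewrite !cycleE; first by rewrite raddf0.
move=> /eqP u0 /eqP v0; apply/eqP; refine (etrans (aqbd_is_linear c u v) _).
by rewrite u0 v0 scaler0 addr0.
Qed.

HB.instance Definition _ n :=
  GRing.isSubmodClosed.Build B (aqchain n) (@aqcycle n) (@aqcycle_submod_closed n).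

Definition aqcycles (n : nat) := {z : aqchain n | z \in @aqcycle n}.
HB.instance Definition _ n := SubChoice.on (aqcycles n).
HB.instance Definition _ n := [SubChoice_isSubLmodule of aqcycles n by <:].

(** The [n]-th André-Quillen homology module [H_n(A, B, E)]: the homology of
    the complex [Omega_{P_n/A} (x)_{P_n} E] with the alternating sum of the faces
    as boundary. *)
Definition AQ (n : nat) :=
  quotmod [set z : aqcycles n | exists w, aqbd w = \val z].
HB.instance Definition _ n := GRing.Lmodule.on (AQ n).
End Homology.

Definition integrally_closed (A : idomainType) : Prop :=
  forall x : {fraction A}, integralOver (@tofrac A) x -> exists y, x = tofrac y.

Section Adjoin.
Variables (A : idomainType) (x : {fraction A}).

Definition adjoin_pred : {pred {fraction A}} :=
  fun y => `[< exists p : {poly A}, y = (map_poly (@tofrac A) p).[x] >].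

Lemma adjoin_predP y : reflect (exists p : {poly A}, y = (map_poly (@tofrac A) p).[x])
  (y \in adjoin_pred).
Proof. exact: asboolP. Qed.

Lemma adjoin_subring_closed : subring_closed adjoin_pred.
Proof.
split=> [|_ _ /adjoin_predP[p ->] /adjoin_predP[q ->]
         |_ _ /adjoin_predP[p ->] /adjoin_predP[q ->]]; apply/adjoin_predP.
- by exists 1; rewrite rmorph1 hornerC.
- by exists (p - q); rewrite rmorphB /= hornerD hornerN.
- by exists (p * q); rewrite rmorphM /= hornerM.
Qed.

HB.instance Definition _ :=
  GRing.isSubringClosed.Build {fraction A} adjoin_pred adjoin_subring_closed.

(** The subring [A[x]] of the fraction field of [A]. *)
Definition adjoin := {y : {fraction A} | y \in adjoin_pred}.
HB.instance Definition _ := SubChoice.on adjoin.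
HB.instance Definition _ := [SubChoice_isSubComNzRing of adjoin by <:].

Lemma tofrac_adjoin a : tofrac a \in adjoin_pred.
Proof. by apply/adjoin_predP; exists a%:P; rewrite map_polyC hornerC. Qed.

Definition adjoin_str (a : A) : adjoin := Sub (tofrac a) (tofrac_adjoin a).

Lemma adjoin_str_is_zmod_morphism : zmod_morphism adjoin_str.
Proof. by move=> a b; apply: val_inj; rewrite /= rmorphB. Qed.

Lemma adjoin_str_is_monoid_morphism : monoid_morphism adjoin_str.
Proof. by split=> [|a b]; apply: val_inj; rewrite /= ?rmorph1 ?rmorphM. Qed.

HB.instance Definition _ :=
  GRing.isZmodMorphism.Build A adjoin adjoin_str adjoin_str_is_zmod_morphism.
HB.instance Definition _ :=
  GRing.isMonoidMorphism.Build A adjoin adjoin_str adjoin_str_is_monoid_morphism.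
End Adjoin.

Section Ideals.
Variable A : comNzRingType.

Definition principal (a : A) : set A := [set a * x | x in setT].

Definition ideal_mul (I J : set A) : set A :=
  @in_span A A^o [set z | exists x y, [/\ I x, J y & z = x * y]].

(** The ideal generated by [I] (that is, [I] itself when [I] is an ideal), as an
    [A]-module. *)
Definition ideal_mod (I : set A) := {x : A^o | x \in span_pred (I : set A^o)}.
HB.instance Definition _ I := SubChoice.on (ideal_mod I).
HB.instance Definition _ I := [SubChoice_isSubLmodule of ideal_mod I by <:].
End Ideals.

(* Main.v *)
(**
Write [x = a/b] and let [J] be the kernel of [A[X] -> B = A[x]].

[H_1(A, B, B)] is the module of the classes in [J/J^2] of the [p] with [p'(x) = 0]. To see
this on the standard resolution, let [K] be the kernel of [P_0 -> B]. A 1-chain modulo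
boundaries is the class of [[k] - [0]] for some [k] in [K], which only depends on [k] modulo
[K^2], and the boundary of this chain is [dk]; in the other direction
[dq |-> d_0 q - d_1 q] maps 1-chains to [K/K^2] and kills boundaries. One passes from [P_0]
to [A[X]] along morphisms [A[X] -> P_0 -> A[X]] over [B]: their composite on [P_0] differs
from the identity by a derivation with values in [K/K^2], so by an element of [K^2] on every
[k] with [dk = 0].

As [A] is integrally closed, [p(x) = 0] implies that [p = (X - x) q] with the coefficients of
both [q] and [xq] in [A]: the leading coefficient [c] of [p] satisfies [cx] in [A], and one
subtracts [(cX - cx) X^n]. So [J^2] consists of the [(X - x)^2 q] such that the coefficients
of [q] lie in [D^2], where [D] is the ideal of the [c] with [cx] in [A]. Applying the
factorization to [p], then to [q] and [xq], shows that [p(x) = p'(x) = 0] if and only if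
[p = (X - x)^2 q] and [c x^2] is in [A] for every coefficient [c] of [q]. Hence [H_1 = 0] if
and only if [c x^2] in [A] implies [c] in [D^2], and multiplication by [a^2] turns this into
the equality of [a^2A cap b^2A] with [I^2], where [I = aD = aA cap bA].

If [I] is flat then [aI cap bI] is contained in [I^2]; and [a^2 c = b^2 d] implies that [cx] is
integral, hence that [a^2 c] is in [aI cap bI].
*)
Require Import Defs.
From HB Require Import structures.
From mathcomp Require Import all_boot all_order all_algebra.
From mathcomp Require Import ring.
From mathcomp Require Import boolp classical_sets.
From mathcomp.multinomials Require Import monalg.

Set Implicit Arguments.
Unset Strict Implicit.
Unset Printing Implicit Defensive.

Import GRing.Theory.

Local Open Scope ring_scope.
Local Open Scope classical_set_scope.

(** * Universal property of modules of differentials *)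

Section DiffLift.
Variables (A B P : comNzRingType) (s : {rmorphism A -> P}) (g : {rmorphism P -> B}).
Variables (E W : lmodType B) (D : P -> E -> W).
Hypotheses (DP : forall p c e e', D p (c *: e + e') = c *: D p e + D p e')
  (DD : forall p q e, D (p + q) e = D p e + D q e)
  (DM : forall p q e, D (p * q) e = D p (g q *: e) + D q (g p *: e))
  (DC : forall a e, D (s a) e = 0).

Let gen (k : (P * E)%type) : W := D k.1 k.2.

Lemma diff_lift_rel z : diff_rel s g z -> free_lift gen z = 0.
Proof.
case=> [[c [p [e [e' ->]]]]|[p [q [e ->]]]|[p [q [e ->]]]|[a [e ->]]].
- by rewrite raddfB raddfD /= linearZ /= !free_liftU /gen /= DP subrr.
- by rewrite raddfB raddfD /= !free_liftU /gen /= DD subrr.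
- by rewrite raddfB raddfD /= !free_liftU /gen /= DM subrr.
- by rewrite free_liftU /gen /= DC.
Qed.

Definition diff_lift : diffmod s g E -> W := quot_lift diff_lift_rel.
HB.instance Definition _ := GRing.Linear.on diff_lift.

Lemma diff_liftE p e : diff_lift (dsym s g p e) = D p e.
Proof. exact: etrans (quot_liftE _ _) (free_liftU _ _). Qed.
End DiffLift.

Section DiffmodTheory.
Variables (A B P : comNzRingType) (s : {rmorphism A -> P}) (g : {rmorphism P -> B}).
Variable E : lmodType B.

Lemma dsymZ p c (e : E) : dsym s g p (c *: e) = c *: dsym s g p e.
Proof.
have d0 : dsym s g p (0 : E) = 0.
  have := diffP s g p 1 (0 : E) 0; rewrite !scale1r addr0 => /eqP.
  by rewrite addrC -subr_eq subrr eq_sym => /eqP.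
by rewrite -[c *: e]addr0 diffP d0 addr0.
Qed.

Lemma diffmod_ind (Q : diffmod s g E -> Prop) :
    Q 0 -> (forall c u v, Q u -> Q v -> Q (c *: u + v)) ->
  (forall p e, Q (dsym s g p e)) -> forall z, Q z.
Proof.
move=> Q0 QP Qd z; rewrite -[z]quot_reprK [quot_repr z]monalgE raddf_sum.
elim/big_ind: _ => // [u v Qu Qv|[p e] _]; first by rewrite -[u]scale1r; exact: QP.
set c := _@__.
have -> : << c *g (p, e) >> = c *: << (p, e) >> :> {malg B[(P * E)%type]}.
  by apply/malgP => k; rewrite mcoeffZ !mcoeffU mulr_natr.
suff : Q (c *: dsym s g p e) by rewrite /dsym -linearZ.
by rewrite -[X in Q X]addr0; apply: QP.
Qed.
End DiffmodTheory.

(** [C], with [sym], is the module of differentials of [P] over [A] extended to [B] along [g]. *)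
Record universal_derivation (A B P : comNzRingType) (s : {rmorphism A -> P})
    (g : {rmorphism P -> B}) (C : lmodType B) (sym : P -> C) : Prop := {
  symD : forall p q, sym (p + q) = sym p + sym q;
  symM : forall p q, sym (p * q) = g q *: sym p + g p *: sym q;
  symC : forall a, sym (s a) = 0;
  sym_ind : forall Q : C -> Prop, Q 0 -> (forall c u v, Q u -> Q v -> Q (c *: u + v)) ->
    (forall p, Q (sym p)) -> forall z, Q z;
  sym_lift : forall (W : lmodType B) (D : P -> W),
    (forall p q, D (p + q) = D p + D q) ->
    (forall p q, D (p * q) = g q *: D p + g p *: D q) ->
    (forall a, D (s a) = 0) ->
    exists u : {linear C -> W}, forall p, u (sym p) = D p }.

(** As [B^o] is generated by 1, a derivation [D] extends to all symbols by sending [dsym p e] to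
    [e *: D p]. *)
Lemma dsym_universal (A B P : comNzRingType) (s : {rmorphism A -> P})
    (g : {rmorphism P -> B}) :
  universal_derivation s g (fun p => dsym s g p (1 : B^o)).
Proof.
have dsym1 p (e : B^o) : dsym s g p e = (e : B) *: dsym s g p (1 : B^o).
  by rewrite -dsymZ [in RHS]/GRing.scale /= mulr1.
split=> [p q|p q|a|Q Q0 QP Qs|W D DD DM DC].
- exact: diffD.
- by rewrite -!dsymZ; exact: diffM.
- exact: diffC.
- apply: diffmod_ind => // p e; rewrite dsym1 -[X in Q X]addr0; exact: QP.
have DP p c (e e' : B^o) : (c *: e + e' : B) *: D p = c *: ((e : B) *: D p) + (e' : B) *: D p.
  by rewrite scalerDl scalerA.
have DD' p q (e : B^o) : (e : B) *: D (p + q) = (e : B) *: D p + (e : B) *: D q.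
  by rewrite DD scalerDr.
have DM' p q (e : B^o) :
    (e : B) *: D (p * q) = (g q *: e : B) *: D p + (g p *: e : B) *: D q.
  by rewrite DM scalerDr !scalerA ![e * _]mulrC.
have DC' a (e : B^o) : (e : B) *: D (s a) = 0 by rewrite DC scaler0.
exists (diff_lift DP DD' DM' DC') => p.
by rewrite -[RHS]scale1r; exact: diff_liftE.
Qed.

(** * A kernel modulo its square, and derivations into it *)

Section Conormal.
Variables (R B : comNzRingType) (g : {rmorphism R -> B}) (s : B -> R).
Hypothesis sK : cancel s g.

Definition ker_set : set R := [set r | g r = 0].

Lemma in_ker_span r : r \in span_pred (ker_set : set R^o) <-> g r = 0.
Proof.
split=> [/span_predP|gr]; last exact/span_predP/in_span_sub.
elim=> [|c u v gu _ gv]; first exact: rmorph0.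
by rewrite rmorphD rmorphM /= gu gv mulr0 addr0.
Qed.

Definition ker_prod : set (ideal_mod ker_set) :=
  [set v | exists j k, [/\ g j = 0, g k = 0 & \val v = j * k]].

(** [ker g / (ker g)^2], on which [B] acts through the section [s]; this does not depend
    on [s], which need not be additive. *)
Definition conormal of cancel s g : Type := quotmod ker_prod.
Local Notation N := (conormal sK).
HB.instance Definition _ := GRing.Zmodule.copy N (quotmod ker_prod).

(** Outside the kernel of [g] this takes the junk value 0, hence the hypotheses [g r = 0] below. *)
Definition cn (r : R) : N := quot_pi ker_prod (insubd 0 r).

Lemma cn_surj (m : N) : exists2 r, g r = 0 & m = cn r.
Proof.
exists (\val (quot_repr m)); first exact/in_ker_span/(valP (quot_repr m)).
by rewrite /cn valKd quot_reprK.
Qed.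

Lemma val_insub_ker r : g r = 0 -> \val (insubd 0 r : ideal_mod ker_set) = r.
Proof. by move=> /in_ker_span gr; rewrite val_insubd gr. Qed.

Lemma cn_eq0 r : g r = 0 -> (cn r = 0 <-> ideal_mul ker_set ker_set r).
Proof.
move=> gr; rewrite /cn -[X in _ = X](raddf0 (quot_pi ker_prod)); split.
  move/quot_pi_eq; rewrite subr0 -{2}(val_insub_ker gr).
  elim=> [|c u v [j [k [gj gk def_u]]] _ IH]; first exact: in_span0.
  by apply: in_spanZD; [exists j, k | exact: IH].
move=> r2; apply/quot_pi_eq; rewrite subr0.
have: \val (insubd 0 r : ideal_mod ker_set) = r by exact: val_insub_ker.
move: (insubd _ _) => v; elim: r2 v => {r gr} [|c u w uS _ IH] v def_v.
  by have -> : v = 0 by [apply: val_inj]; exact: in_span0.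
case: uS => j [k [gj gk def_u]].
have gu : g u = 0 by rewrite def_u rmorphM /= gj mul0r.
have gw : g w = 0.
  have gcu : g (c * u) = 0 by rewrite rmorphM /= gu mulr0.
  have /in_ker_span := valP v; rewrite def_v -[c *: u]/(c * u) (rmorphD g) gcu.
  by rewrite add0r.
have -> : v = c *: insubd 0 u + insubd 0 w.
  by apply: val_inj; rewrite def_v /= !val_insub_ker.
apply: in_spanZD; last by apply: IH; exact: val_insub_ker.
by exists j, k; split=> //; rewrite val_insub_ker.
Qed.

Lemma cnD r t : g r = 0 -> g t = 0 -> cn (r + t) = cn r + cn t.
Proof.
move=> gr gt; have grt : g (r + t) = 0 by rewrite rmorphD gr gt addr0.
rewrite /cn -[RHS]raddfD; congr quot_pi.
by apply: val_inj; rewrite /= !val_insub_ker.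
Qed.

Lemma cn_eq r t : g r = 0 -> g t = 0 -> ideal_mul ker_set ker_set (r - t) -> cn r = cn t.
Proof.
move=> gr gt rt; have grt : g (r - t) = 0 by rewrite rmorphB gr gt subrr.
by rewrite -[r](subrK t) cnD // (cn_eq0 grt).2 // add0r.
Qed.

(** The difference [(r - r') * t] is a product of two elements of the kernel. This makes the action
    of [B] through [s] a module structure although [s] need not be a morphism. *)
Lemma cnM r r' t : g r = g r' -> g t = 0 -> cn (r * t) = cn (r' * t).
Proof.
move=> grr' gt; apply: cn_eq; rewrite ?rmorphM /= ?gt ?mulr0 //.
rewrite -mulrBl; apply: in_span_sub; exists (r - r'), t; split=> //.
by rewrite /ker_set /= rmorphB grr' subrr.
Qed.

Definition cn_scale (b : B) (m : N) : N := cn (s b * xget 0 [set r | g r = 0 /\ m = cn r]).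

Lemma cn_scaleE b t : g t = 0 -> cn_scale b (cn t) = cn (s b * t).
Proof.
move=> gt; rewrite /cn_scale.
case: xgetP => [r _ [gr ert]|/(_ t)]; last by case.
apply: cn_eq; rewrite ?rmorphM /= ?gt ?gr ?mulr0 //.
rewrite -mulrBr; apply: (@in_spanZ _ R^o).
have grt : g (r - t) = 0 by rewrite rmorphB gr gt subrr.
have: cn (r - t) = 0.
  by apply: (addIr (cn t)); rewrite add0r -cnD // subrK.
by case: (cn_eq0 grt).
Qed.

Lemma cn_scaleA a b x : cn_scale a (cn_scale b x) = cn_scale (a * b) x.
Proof.
have [t gt ->] := cn_surj x; rewrite !cn_scaleE ?rmorphM ?gt ?mulr0 // mulrA.
by apply: cnM; rewrite // rmorphM /= !sK.
Qed.

Lemma cn_scale1 : left_id 1 cn_scale.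
Proof.
move=> x; have [t gt ->] := cn_surj x; rewrite cn_scaleE // -[in RHS](mul1r t).
by apply: cnM; rewrite // sK rmorph1.
Qed.

Lemma cn_scaleDr : right_distributive cn_scale +%R.
Proof.
move=> c x y; have [t gt ->] := cn_surj x; have [u gu ->] := cn_surj y.
rewrite -cnD // !cn_scaleE ?rmorphD ?gt ?gu ?addr0 // mulrDr cnD //.
  by rewrite rmorphM /= gt mulr0.
by rewrite rmorphM /= gu mulr0.
Qed.

Lemma cn_scaleDl x : {morph cn_scale^~ x : a b / a + b}.
Proof.
move=> a b; have [t gt ->] := cn_surj x; rewrite !cn_scaleE // -cnD ?rmorphM ?gt ?mulr0 //.
by rewrite -mulrDl; apply: cnM; rewrite // rmorphD /= !sK.
Qed.

HB.instance Definition _ := GRing.Zmodule_isLmodule.Build B N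
  cn_scaleA cn_scale1 cn_scaleDr cn_scaleDl.

Lemma cnZ r t : g t = 0 -> cn (r * t) = g r *: cn t.
Proof.
move=> gt; rewrite -[RHS]/(cn_scale _ _) cn_scaleE //.
by apply: cnM; rewrite // sK.
Qed.

Lemma cnB r t : g r = 0 -> g t = 0 -> cn (r - t) = cn r - cn t.
Proof.
move=> gr gt; rewrite cnD ?rmorphN ?gt ?oppr0 // -mulN1r cnZ // rmorphN1.
by rewrite scaleN1r.
Qed.
End Conormal.

(** Modulo the square of the kernel, [u - v] is a derivation: [u (p * q) - v (p * q) = v q * (u p -
    v p) + u p * (u q - v q)], where [v q] acts as [g q] and [u p] as [g p]. *)
Lemma diff_sub_lift (A B P R : comNzRingType) (s : {rmorphism A -> P}) (g : {rmorphism P -> B})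
    (C : lmodType B) (sym : P -> C) (sym_univ : universal_derivation s g sym)
    (gR : {rmorphism R -> B}) (sec : B -> R) (secK : cancel sec gR)
    (u v : {rmorphism P -> R}) :
  (forall a, u (s a) = v (s a)) ->
  (forall p, gR (u p) = g p) -> (forall p, gR (v p) = g p) ->
  exists D : {linear C -> conormal secK}, forall p, D (sym p) = cn secK (u p - v p).
Proof.
move=> uvs gu gv; have ker p : gR (u p - v p) = 0 by rewrite rmorphB /= gu gv subrr.
apply: (sym_lift sym_univ) => [p q|p q|a].
- by rewrite -cnD ?ker //; congr cn; rewrite !rmorphD opprD addrACA.
- rewrite -(gv q) -(gu p) -!cnZ ?ker // -cnD ?rmorphM /= ?ker ?mulr0 //.
  by congr cn; ring.
by rewrite uvs subrr (cn_eq0 secK (rmorph0 gR)).2 //; exact: in_span0.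
Qed.

Lemma poly_rmorph_ext (A S : comNzRingType) (u v : {rmorphism {poly A} -> S}) :
  (forall a, u a%:P = v a%:P) -> u 'X = v 'X -> u =1 v.
Proof.
move=> uvC uvX; elim/poly_ind=> [|p c IH]; first by rewrite !rmorph0.
by rewrite !rmorphD !rmorphM /= IH uvX uvC.
Qed.

Lemma ker_mul_rmorph (B R S : comNzRingType) (g : {rmorphism R -> B})
    (g' : {rmorphism S -> B}) (h : {rmorphism R -> S}) r :
  (forall r', g' (h r') = g r') ->
  ideal_mul (ker_set g) (ker_set g) r -> ideal_mul (ker_set g') (ker_set g') (h r).
Proof.
move=> gh; elim=> [|c u v [j [k [gj gk ->]]] _ IH]; first by rewrite rmorph0; exact: in_span0.
rewrite rmorphD; apply: (@in_spanD _ S^o) => //.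
rewrite -[_ *: _]/(c * (j * k)) !rmorphM; apply: (@in_spanZ _ S^o).
by apply: in_span_sub; exists (h j), (h k); rewrite /ker_set /= !gh.
Qed.

(** * First homology of a resolution, and double roots *)

(** [P0], [P1], [P2] are the first three rings of a free simplicial resolution of [B]
    with faces [dij], and [v0], [v1], [v2] are the inclusions of their sets of variables;
    [C0], [C1], [C2] are their modules of differentials over [B]. *)
Section TruncatedResolution.
Variables (A B P0 P1 P2 : comNzRingType) (f : {rmorphism A -> B}).
Variables (s0 : {rmorphism A -> P0}) (s1 : {rmorphism A -> P1}) (s2 : {rmorphism A -> P2}).
Variables (g0 : {rmorphism P0 -> B}) (g1 : {rmorphism P1 -> B}) (g2 : {rmorphism P2 -> B}).
Variables (d10 d11 : {rmorphism P1 -> P0}) (d20 d21 d22 : {rmorphism P2 -> P1}).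
Hypotheses (d10s : forall a, d10 (s1 a) = s0 a) (d11s : forall a, d11 (s1 a) = s0 a).
Hypotheses (g0d10 : forall p, g0 (d10 p) = g1 p) (g0d11 : forall p, g0 (d11 p) = g1 p).
Hypotheses (d10d21 : forall p, d10 (d21 p) = d10 (d20 p))
  (d10d22 : forall p, d10 (d22 p) = d11 (d20 p)) (d11d22 : forall p, d11 (d22 p) = d11 (d21 p)).
Variables (v0 : B -> P0) (v1 : P0 -> P1) (v2 : P1 -> P2).
Hypotheses (g0v : cancel v0 g0) (d10v : cancel v1 d10) (d11v : forall p, d11 (v1 p) = v0 (g0 p)).
Hypotheses (d20v : cancel v2 d20) (d21v : forall p, d21 (v2 p) = v1 (d10 p))
  (d22v : forall p, d22 (v2 p) = v1 (d11 p)).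
Variables (C0 C1 C2 : lmodType B) (sym0 : P0 -> C0) (sym1 : P1 -> C1) (sym2 : P2 -> C2).
Hypotheses (sym0_univ : universal_derivation s0 g0 sym0)
  (sym1_univ : universal_derivation s1 g1 sym1) (sym2_univ : universal_derivation s2 g2 sym2).
Variables (bd1 : {linear C1 -> C0}) (bd2 : {linear C2 -> C1}).
Hypotheses (bd1E : forall q, bd1 (sym1 q) = sym0 (d10 q) - sym0 (d11 q)).
Hypotheses (bd2E : forall r, bd2 (sym2 r) = sym1 (d20 r) - sym1 (d21 r) + sym1 (d22 r)).
Hypotheses (bd_bd : forall w, bd1 (bd2 w) = 0).

Lemma sym00 : sym0 0 = 0.
Proof. by rewrite -(rmorph0 s0) (symC sym0_univ). Qed.

(** The chain is the [k] - [0] of the overview: [v1 k] and [v1 0] have the same second face [v0 0],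
    which cancels. *)
Lemma bd1_var_sub k : g0 k = 0 -> bd1 (sym1 (v1 k) - sym1 (v1 0)) = sym0 k.
Proof.
move=> k0; rewrite raddfB /= !bd1E !d10v !d11v k0 rmorph0 sym00.
by rewrite sub0r opprK subrK.
Qed.

Lemma g1v p : g1 (v1 p) = g0 p.
Proof. by rewrite -g0d10 d10v. Qed.

Section Poly.
Variables (x : B) (sec : B -> {poly A}).

Definition evalX : {rmorphism {poly A} -> B} := horner_eval x \o map_poly f.

Hypothesis secK : cancel sec evalX.
Variables (phi : {rmorphism {poly A} -> P0}) (psi : {rmorphism P0 -> {poly A}}).
Hypotheses (phiC : forall a, phi a%:P = s0 a) (phiX : phi 'X = v0 x).
Hypotheses (psis : forall a, psi (s0 a) = a%:P) (phiK : cancel phi psi).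
Hypotheses (evpsi : forall p, evalX (psi p) = g0 p).

Lemma evalXX : evalX 'X = x.
Proof. by rewrite /= /horner_eval map_polyX hornerX. Qed.

Lemma g0phi p : g0 (phi p) = evalX p.
Proof. by rewrite -evpsi phiK. Qed.

Lemma sym_phi p : sym0 (phi p) = evalX p^`() *: sym0 (v0 x).
Proof.
elim/poly_ind: p => [|p c IH]; first by rewrite deriv0 !rmorph0 scale0r sym00.
rewrite derivD derivC addr0 derivM derivX mulr1 !rmorphD !rmorphM phiC phiX.
rewrite (symD sym0_univ) (symC sym0_univ) addr0 (symM sym0_univ) g0v g0phi evalXX.
by rewrite IH scalerA scalerDl [x * _]mulrC.
Qed.

Lemma double_root_of_acyclic : (forall z, bd1 z = 0 -> exists w, bd2 w = z) ->
  forall p, evalX p = 0 -> evalX p^`() = 0 -> ideal_mul (ker_set evalX) (ker_set evalX) p.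
Proof.
move=> bd p p0 p'0; have k0 : g0 (phi p) = 0 by rewrite g0phi.
(* This is dq |-> d_0 q - d_1 q, followed by [psi] so as to land in J/J^2. *)
have [D DE] : exists D : {linear C1 -> conormal secK},
    forall q, D (sym1 q) = cn secK (psi (d10 q) - psi (d11 q)).
  apply: (diff_sub_lift sym1_univ secK (u := psi \o d10) (v := psi \o d11)) => [a|q|q] /=.
  - by rewrite d10s d11s.
  - by rewrite [LHS]evpsi g0d10.
  - by rewrite [LHS]evpsi g0d11.
have D_bd w : D (bd2 w) = 0.
  elim/(sym_ind sym2_univ): w => [|c u v u0 v0'|q]; first by rewrite !raddf0.
    by rewrite !linearP u0 v0' scaler0 addr0.
  rewrite bd2E raddfD raddfB /= !DE.
  have ev0 q' : evalX (psi (d10 q') - psi (d11 q')) = 0.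
    by rewrite rmorphB !evpsi g0d10 g0d11 subrr.
  have e01 : evalX (psi (d10 (d20 q)) - psi (d11 (d20 q)) -
                    (psi (d10 (d21 q)) - psi (d11 (d21 q)))) = 0.
    by rewrite rmorphB !ev0 subrr.
  (* By the simplicial identities the six terms cancel in pairs. *)
  rewrite -cnB // -cnD // d10d21 d11d22 d10d22.
  set r := (X in cn _ X); have -> : r = 0 by rewrite /r; ring.
  by rewrite (cn_eq0 secK (rmorph0 _)).2 //; exact: in_span0.
(* This chain is a cycle: its boundary is the differential of [phi p], a multiple of p'(x) = 0. *)
have [w def_w] : exists w, bd2 w = sym1 (v1 (phi p)) - sym1 (v1 0).
  by apply: bd; rewrite bd1_var_sub // sym_phi p'0 scale0r.
have := D_bd w.
rewrite def_w raddfB /= !DE !d10v !d11v k0 rmorph0 sub0r phiK rmorph0.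
(* [D] sends the two symbols to the classes of [p - y] and [- y]; [y] lies in J, need not vanish,
   and cancels. *)
set y := psi (v0 0).
have y0 : evalX y = 0 by rewrite /y evpsi g0v.
have ry0 : evalX (- y) = 0 by rewrite rmorphN y0 oppr0.
have py0 : evalX (p - y) = 0 by rewrite rmorphB p0 y0 subrr.
rewrite -cnB //.
by rewrite opprK subrK; exact: (cn_eq0 secK p0).1.
Qed.

(** Through this map, [sym0 k = 0] forces the derivative of [psi k] to vanish at [x]. *)
Lemma psi_deriv : exists D : {linear C0 -> B^o}, forall p, D (sym0 p) = evalX (psi p)^`().
Proof.
apply: (sym_lift sym0_univ) => [p q|p q|a].
- by rewrite (rmorphD psi) derivD (rmorphD evalX).
- rewrite (rmorphM psi) derivM (rmorphD evalX) !(rmorphM evalX) !evpsi.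
  by rewrite [X in X + _]mulrC.
- by rewrite psis derivC rmorph0.
Qed.

(** The identity and [phi \o psi] are morphisms over [B] that agree on [A], so their difference
    modulo the square of the kernel factors through [sym0]. *)
Lemma phi_psi_mod k : g0 k = 0 -> sym0 k = 0 ->
  ideal_mul (ker_set g0) (ker_set g0) (k - phi (psi k)).
Proof.
move=> k0 dk.
have [D DE] : exists D : {linear C0 -> conormal g0v},
    forall p, D (sym0 p) = cn g0v (p - phi (psi p)).
  apply: (diff_sub_lift sym0_univ g0v (u := idfun) (v := phi \o psi)) => [a|q|q] //=.
    by rewrite psis phiC.
  by rewrite g0phi evpsi.
have := DE k; rewrite dk raddf0 => /esym.
have kk0 : g0 (k - phi (psi k)) = 0 by rewrite rmorphB k0 g0phi evpsi k0 subrr.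
by case: (cn_eq0 g0v kk0).
Qed.

Section ChainClass.
Variables (Q : lmodType B) (piQ : {linear C1 -> Q}).
Hypothesis chain_class_eq0 : forall z, piQ z = 0 <-> exists w, bd2 w = z.

(** Classes of the chains [sym1 (v1 p)] modulo boundaries; [br_sub k] is the class
    corresponding to [k] under the isomorphism of the kernel of [g0], modulo its
    square, with the 1-chains modulo boundaries. *)
Let br (p : P0) : Q := piQ (sym1 (v1 p)).
Let br_sub k : Q := br k - br 0.

(** The boundary of [sym2 (v2 q)] is [sym1 q - sym1 (v1 (d10 q)) + sym1 (v1 (d11 q))]. *)
Lemma chain_class_sym q : piQ (sym1 q) = br (d10 q) - br (d11 q).
Proof.
apply/eqP; rewrite -subr_eq0 /br -!raddfB; apply/eqP/chain_class_eq0.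
by exists (sym2 (v2 q)); rewrite bd2E d20v d21v d22v opprB addrCA addrC.
Qed.

(** The lemmas below apply this to sums and products of variables whose second faces agree, and so
    obtain the relations between values of [br]. *)
Lemma br_face q q' : d11 q = d11 q' ->
  br (d10 q) - br (d10 q') = piQ (sym1 q) - piQ (sym1 q').
Proof.
by move=> e; rewrite (chain_class_sym q) (chain_class_sym q') e opprB addrA subrK.
Qed.

Lemma br_subD k k' : g0 k = 0 -> g0 k' = 0 -> br_sub (k + k') = br_sub k + br_sub k'.
Proof.
move=> k0 k'0.
have /br_face : d11 (v1 k + v1 k') = d11 (v1 0 + v1 0).
  by rewrite !rmorphD !d11v k0 k'0 rmorph0.
rewrite !rmorphD !d10v addr0 !(symD sym1_univ) !(raddfD piQ) => e.
by rewrite /br_sub e opprD addrACA.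
Qed.

Lemma br_subM p k : g0 k = 0 -> br_sub (p * k) = g0 p *: br_sub k.
Proof.
move=> k0.
have /br_face : d11 (v1 p * v1 k) = d11 (v1 p * v1 0).
  by rewrite !rmorphM !d11v k0 rmorph0.
rewrite !rmorphM !d10v mulr0 !(symM sym1_univ) !g1v k0 rmorph0 !scale0r !add0r.
by rewrite !(linearZ_LR piQ) -scalerBr.
Qed.

Lemma br_sub_diff p p' : g0 p = g0 p' -> br p - br p' = br_sub (p - p').
Proof.
move=> pp'.
have /br_face : d11 (v1 (p - p') + v1 p') = d11 (v1 0 + v1 p').
  by rewrite !rmorphD !d11v rmorphB pp' subrr rmorph0.
rewrite !rmorphD !d10v add0r subrK !(symD sym1_univ) !(raddfD piQ) => ->.
by rewrite /br_sub opprD addrACA subrr addr0.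
Qed.

Lemma br_sub_surj z : exists2 k, g0 k = 0 & piQ z = br_sub k.
Proof.
elim/(sym_ind sym1_univ): z => [|c u v [k k0 def_u] [k' k'0 def_v]|q].
- by exists 0; rewrite ?rmorph0 // /br_sub subrr raddf0.
- have ck0 : g0 (v0 c * k) = 0 by rewrite rmorphM k0 mulr0.
  exists (v0 c * k + k'); first by rewrite rmorphD ck0 k'0 addr0.
  by rewrite br_subD // br_subM // g0v -def_u -def_v linearP.
exists (d10 q - d11 q); first by rewrite rmorphB g0d10 g0d11 subrr.
by rewrite chain_class_sym br_sub_diff // g0d10 g0d11.
Qed.

Lemma br_sub_mul k : ideal_mul (ker_set g0) (ker_set g0) k -> br_sub k = 0.
Proof.
(* Membership in the kernel is carried through the induction because [br_subD] asks for it. *)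
suff : ideal_mul (ker_set g0) (ker_set g0) k -> g0 k = 0 /\ br_sub k = 0 by move=> H /H[].
elim=> [|c u v [j [j' [j0 j'0 ->]]] _ [w0 IH]]; first by rewrite rmorph0 /br_sub subrr.
have cj0 : g0 (c * (j * j')) = 0 by rewrite !rmorphM j0 mul0r mulr0.
rewrite -[_ *: _]/(c * (j * j')) rmorphD cj0 w0 addr0; split=> //.
rewrite br_subD // IH addr0 mulrA br_subM //.
by rewrite rmorphM j0 mulr0 scale0r.
Qed.

Lemma acyclic_of_double_root :
  (forall p, evalX p = 0 -> evalX p^`() = 0 -> ideal_mul (ker_set evalX) (ker_set evalX) p) ->
  forall z, bd1 z = 0 -> exists w, bd2 w = z.
Proof.
move=> dbl z dz.
have [k k0 def_z] := br_sub_surj z; apply/chain_class_eq0; rewrite def_z; apply: br_sub_mul.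
(* [z] and [k] - [0] differ by a boundary, so [bd1] takes the same value on both: 0 on the former,
   [sym0 k] on the latter. *)
have dk : sym0 k = 0.
  have /chain_class_eq0[w def_w] : piQ (z - (sym1 (v1 k) - sym1 (v1 0))) = 0.
    by rewrite raddfB /= def_z raddfB subrr.
  rewrite -bd1_var_sub //; have := bd_bd w; rewrite def_w raddfB /= dz.
  by rewrite sub0r => /eqP; rewrite oppr_eq0 => /eqP.
(* The summand [k - phi (psi k)] lies in the square of the kernel by [phi_psi_mod]; the other one is
   the image of [psi k], which vanishes at [x] together with its derivative. *)
rewrite -[k](subrK (phi (psi k))); apply: (@in_spanD _ P0^o).
  exact: phi_psi_mod.
apply: ker_mul_rmorph g0phi _; apply: dbl; first by rewrite evpsi.
by have [D DE] := psi_deriv; have := DE k; rewrite dk raddf0.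
Qed.
End ChainClass.
End Poly.
End TruncatedResolution.

(** * The standard resolution in low degrees *)

Section FirstHomology.
Variables (A B : comNzRingType) (f : {rmorphism A -> B}).

Lemma AQ_eq0 (E : lmodType B) n :
  (forall h : AQ f E n, h = 0) <->
  (forall z : aqchain f E n, z \in @aqcycle A B f E n -> exists w, aqbd w = z).
Proof.
split=> [h0 z z_cycle|bd h].
  have /quot_pi_eq : quot_pi [set z : aqcycles f E n | exists w, aqbd w = \val z] (Sub z z_cycle)
      = quot_pi _ 0 by rewrite raddf0; exact: h0.
  rewrite subr0 -[z]/(\val (Sub z z_cycle : aqcycles f E n)).
  elim=> [|c u v [w def_u] _ [w' def_v]]; first by exists 0; rewrite raddf0.
  by exists (c *: w + w'); apply: etrans (aqbd_is_linear c w w') _; rewrite def_u def_v.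
rewrite -[h]quot_reprK -(raddf0 (quot_pi _)); apply/quot_pi_eq; rewrite subr0.
by apply: in_span_sub; apply: bd; exact: (valP (quot_repr h)).
Qed.

Local Notation C := (aqchain f B^o).

Definition chain_sym n (p : aqres A B n.+1) : C n :=
  dsym (aqstr f n.+1) (aqaug f n.+1) p (1 : B^o).

Lemma aqbd0_sym p :
  aqbd (@chain_sym 1 p) = chain_sym (aqface f 1 0 p) - chain_sym (aqface f 1 1 p).
Proof.
have sum2 (V : lmodType B) (F : nat -> V) x y : F 0%N = x -> F 1%N = y ->
    \sum_(i < 2) (-1) ^+ i *: F i = x - y.
  by move=> <- <-; rewrite !big_ord_recl big_ord0 addr0 /= expr0 expr1 scale1r scaleN1r.
exact: (sum2 (C 0) (fun i => aqchain_face i (chain_sym p)) _ _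
  (aqchain_faceE f 0 p 1) (aqchain_faceE f 1 p 1)).
Qed.

Lemma aqbd1_sym p :
  aqbd (@chain_sym 2 p) =
  chain_sym (aqface f 2 0 p) - chain_sym (aqface f 2 1 p) + chain_sym (aqface f 2 2 p).
Proof.
have sum3 (V : lmodType B) (F : nat -> V) x y z : F 0%N = x -> F 1%N = y -> F 2%N = z ->
    \sum_(i < 3) (-1) ^+ i *: F i = x - y + z.
  move=> <- <- <-; rewrite !big_ord_recl big_ord0 addr0 /= expr0 expr1 scale1r scaleN1r.
  by rewrite exprS expr1 mulN1r opprK scale1r addrA.
exact: (sum3 (C 1) (fun i => aqchain_face i (chain_sym p)) _ _ _
  (aqchain_faceE f 0 p 1) (aqchain_faceE f 1 p 1) (aqchain_faceE f 2 p 1)).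
Qed.

Lemma chain_sym_universal n :
  universal_derivation (aqstr f n.+1) (aqaug f n.+1) (@chain_sym n).
Proof. exact: dsym_universal. Qed.

Section Poly.
Variables (x : B) (sec : B -> {poly A}).
Hypothesis secK : cancel sec (evalX f x).

Lemma evalXC a : evalX f x a%:P = f a.
Proof. by rewrite /= /horner_eval map_polyC hornerC. Qed.

Definition poly_to_res : {rmorphism {poly A} -> aqres A B 1} :=
  horner_eval (@aqvar A B 0 x) \o map_poly (aqstr f 1).

Lemma poly_to_resC a : poly_to_res a%:P = aqstr f 1 a.
Proof. by rewrite /= /horner_eval map_polyC hornerC. Qed.

Lemma poly_to_resX : poly_to_res 'X = @aqvar A B 0 x.
Proof. by rewrite /= /horner_eval map_polyX hornerX. Qed.

(** Sending the variable [x] to ['X] instead of [sec x] makes this a left inverse of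
    [poly_to_res]. *)
Definition res_to_poly : {rmorphism aqres A B 1 -> {poly A}} :=
  polyeval (@polyC A) (fun y : B => if y == x then 'X else sec y).

Lemma res_to_polyC a : res_to_poly (aqstr f 1 a) = a%:P.
Proof. exact: polyevalC. Qed.

Lemma res_to_poly_var y : res_to_poly (@aqvar A B 0 y) = if y == x then 'X else sec y.
Proof. exact: polyeval_var. Qed.

Lemma poly_to_resK : cancel poly_to_res res_to_poly.
Proof.
apply: (poly_rmorph_ext (u := res_to_poly \o poly_to_res) (v := idfun)) => [a|].
  by rewrite [LHS](congr1 res_to_poly (poly_to_resC a)) res_to_polyC.
by rewrite [LHS](congr1 res_to_poly poly_to_resX) res_to_poly_var eqxx.
Qed.

Lemma aqaug1_var y : aqaug f 1 (@aqvar A B 0 y) = y.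
Proof. exact: (@aqface0_var A B f 0 y). Qed.

Lemma evalX_res_to_poly p : evalX f x (res_to_poly p) = aqaug f 1 p.
Proof.
apply: (aqres_ext (g := evalX f x \o res_to_poly) (h := aqaug f 1)) => [a|y].
  apply: etrans (congr1 (evalX f x) (res_to_polyC a)) _.
  exact: etrans (evalXC a) (esym (aqaug_str f 1 a)).
apply: etrans (congr1 (evalX f x) (res_to_poly_var y)) _; apply: etrans (esym (aqaug1_var y)).
by case: eqP => [->|_]; [exact: evalXX | exact: secK].
Qed.

Lemma AQ1_eq0 :
  (forall h : AQ f B^o 1, h = 0) <->
  (forall p, evalX f x p = 0 -> evalX f x p^`() = 0 ->
     ideal_mul (ker_set (evalX f x)) (ker_set (evalX f x)) p).
Proof.
have d10d21 p : aqface f 1 0 (aqface f 2 1 p) = aqface f 1 0 (aqface f 2 0 p).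
  exact: (@aqface_face A B f 1 0 0).
have d10d22 p : aqface f 1 0 (aqface f 2 2 p) = aqface f 1 1 (aqface f 2 0 p).
  exact: (@aqface_face A B f 1 0 1).
have d11d22 p : aqface f 1 1 (aqface f 2 2 p) = aqface f 1 1 (aqface f 2 1 p).
  exact: (@aqface_face A B f 1 1 1).
have d11v p : aqface f 1 1 (@aqvar A B 1 p) = @aqvar A B 0 (aqaug f 1 p).
  exact: (aqfaceS_var f 0 p).
have d21v p : aqface f 2 1 (@aqvar A B 2 p) = @aqvar A B 1 (aqface f 1 0 p).
  exact: (aqfaceS_var f 0 p).
have d22v p : aqface f 2 2 (@aqvar A B 2 p) = @aqvar A B 1 (aqface f 1 1 p).
  exact: (aqfaceS_var f 1 p).
(* The 1-chains modulo boundaries serve as the module [Q] of the truncated resolution. *)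
have piQE z : quot_pi [set z : C 1 | exists w, aqbd w = z] z = 0 <-> exists w, aqbd w = z.
  rewrite -[X in _ = X](raddf0 (quot_pi _)); split=> [/quot_pi_eq|z_bd].
    rewrite subr0; elim=> [|c u v [w def_u] _ [w' def_v]]; first by exists 0; rewrite raddf0.
    by exists (c *: w + w'); apply: etrans (aqbd_is_linear c w w') _; rewrite def_u def_v.
  by apply/quot_pi_eq; rewrite subr0; exact: in_span_sub.
split=> [/AQ_eq0 h0 p|dbl].
  apply: (double_root_of_acyclic (aqface_str f 1 0) (aqface_str f 1 1) (aqaug_face f (n := 1) 0)
    (aqaug_face f (n := 1) 1) d10d21 d10d22 d11d22 aqaug1_var (aqface0_var f (n := 1)) d11v
    (chain_sym_universal 0) (chain_sym_universal 1) (chain_sym_universal 2)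
    aqbd0_sym aqbd1_sym secK poly_to_resC poly_to_resX poly_to_resK evalX_res_to_poly) => z dz.
  by apply: h0; apply/eqP.
apply/AQ_eq0 => z /eqP.
apply: (acyclic_of_double_root (aqaug_face f (n := 1) 0)
    (aqaug_face f (n := 1) 1) aqaug1_var (aqface0_var f (n := 1)) d11v
    (aqface0_var f (n := 2)) d21v d22v
    (chain_sym_universal 0) (chain_sym_universal 1) 
    aqbd0_sym aqbd1_sym (@aqbd_bd A B f B^o 0) poly_to_resC res_to_polyC poly_to_resK
    evalX_res_to_poly piQE dbl).
Qed.
End Poly.
End FirstHomology.

(** * Polynomials with root x over an integrally closed domain *)

Section FractionRoot.
Variables (A : idomainType) (A_closed : integrally_closed A) (x : {fraction A}).
Local Notation iota := (@tofrac A).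
Local Notation "p ^f" := (map_poly (@tofrac A) p).
Local Notation Xx := ('X - x%:P).

(** The ideal D of the overview; [root_set] is J. *)
Definition den_set : set A := [set c | exists y, x * iota c = iota y].
Definition root_set : set {poly A} := [set p | p^f.[x] = 0].

Lemma tofrac_inj : injective iota.
Proof. by move=> u v /eqP; rewrite tofrac_eq => /eqP. Qed.

Lemma mapf_inj : injective (map_poly iota).
Proof. by apply: map_inj_poly; [exact: tofrac_inj | exact: tofrac0]. Qed.

(** For [p] of degree n + 1 with leading coefficient c, multiplying p(x) = 0 by c^n gives a monic
    equation for cx. *)
Lemma lead_coef_den p : root_set p -> (1 < size p)%N -> den_set (lead_coef p).
Proof.
rewrite /root_set /= => p0 p_gt1; apply: A_closed.
set c := lead_coef p; pose n := (size p).-2.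
have sz_p : size p = n.+2 by rewrite /n; case: (size p) p_gt1 => [|[]].
pose q := 'X^(n.+1) + \poly_(i < n.+1) (p`_i * c ^+ (n - i)).
exists q.
  rewrite monicE lead_coefDl ?lead_coefXn // size_polyXn.
  exact: leq_ltn_trans (size_poly _ _) _.
rewrite /root /q rmorphD /= map_polyXn hornerD hornerXn.
suff -> : (x * iota c) ^+ n.+1 + (\poly_(i < n.+1) (p`_i * c ^+ (n - i)))^f.[x * iota c]
    = iota c ^+ n * p^f.[x] by rewrite p0 mulr0.
have sz_pf : size p^f = n.+2 by rewrite size_map_inj_poly //; exact: tofrac_inj.
rewrite [p^f.[x]]horner_coef sz_pf big_ord_recr /= mulrDr addrC; congr (_ + _).
  rewrite mulr_sumr map_polyE; set r := (X in X.[_]).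
  have -> : r = \poly_(i < n.+1) (iota p`_i * iota c ^+ (n - i)).
    apply/polyP => i; rewrite /r -map_polyE coef_map !coef_poly /=.
    by case: ifP => _; rewrite ?rmorphM ?rmorphXn ?rmorph0.
  rewrite horner_poly; apply: eq_bigr => i _; rewrite coef_map exprMn /=.
  have -> : iota c ^+ n = iota c ^+ (n - i) * iota c ^+ i.
    by rewrite -exprD subnK // -ltnS.
  ring.
have -> : p^f`_n.+1 = iota c by rewrite coef_map /= /c lead_coefE sz_p.
by rewrite exprMn !exprS; ring.
Qed.

Lemma root_factor p : root_set p ->
  exists q, p^f = q^f * Xx /\ forall i, den_set q`_i.
Proof.
have [k] := ubnP (size p); elim: k p => // k IH p lt_pk p0.
have den0 : den_set 0 by exists 0; rewrite rmorph0 mulr0.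
have [p_le1|p_gt1] := leqP (size p) 1.
  exists 0; split=> [|i]; last by rewrite coef0.
  rewrite rmorph0 mul0r; move: p0.
  by rewrite /root_set /= (size1_polyC p_le1) map_polyC hornerC /= => ->.
have [y def_y] := lead_coef_den p0 p_gt1; set c := lead_coef p in def_y.
pose n := (size p).-2.
have sz_p : size p = n.+2 by rewrite /n; case: (size p) p_gt1 => [|[]].
(* As [y] is cx, [l] is c X^n (X - x); it has the leading term of [p], so [p1] has smaller size. *)
pose l := c *: 'X^(n.+1) - y *: 'X^n; pose p1 := p - l.
have def_l : l^f = (c *: 'X^n)^f * Xx.
  rewrite /l rmorphB /= !map_polyZ /= !map_polyXn -!mul_polyC -def_y rmorphM /= exprSr.
  ring.
have p10 : root_set p1.
  by rewrite /root_set /= /p1 rmorphB /= hornerD hornerN p0 def_l hornerM !hornerE subrr mulr0 oppr0.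
have lt_p1 : (size p1 < k)%N.
  rewrite -ltnS (leq_trans _ lt_pk) // ltnS sz_p ltnS.
  apply/leq_sizeP => j; rewrite leq_eqVlt => /orP[/eqP<-|lt_nj].
    rewrite /p1 /l !coefB !coefZ !coefXn eqxx mulr1 (gtn_eqF (ltnSn n)) mulr0 subr0.
    by rewrite /c lead_coefE sz_p subrr.
  rewrite /p1 /l !coefB !coefZ !coefXn (gtn_eqF lt_nj) (gtn_eqF (ltn_trans (ltnSn n) lt_nj)).
  by rewrite !mulr0 subrr subr0 nth_default // sz_p.
have [q1 [def_p1 q1_den]] := IH p1 lt_p1 p10.
exists (q1 + c *: 'X^n); split=> [|i].
  by rewrite -[p](subrK l) -/p1 rmorphD /= def_p1 def_l -mulrDl -rmorphD.
rewrite coefD coefZ coefXn; have [z def_z] := q1_den i.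
case: eqP => _; rewrite ?mulr1 ?mulr0 ?addr0; last by exists z.
by exists (z + y); rewrite !rmorphD mulrDr def_z def_y.
Qed.

(** The first quotient q and its multiple xq have coefficients in [A] and root [x]. Their quotients
    r and r2 by X - x satisfy r2 = xr, and the coefficients of r2 lie in D. *)
Lemma double_root_factor p : root_set p -> root_set p^`() ->
  exists q, p^f = q^f * Xx ^+ 2 /\ forall i, exists y, x ^+ 2 * iota q`_i = iota y.
Proof.
move=> p0 dp0; have [q [def_p q_den]] := root_factor p0.
have q0 : root_set q.
  move: dp0; rewrite /root_set /= -deriv_map def_p derivM derivXsubC mulr1 hornerD hornerM.
  by rewrite !hornerE subrr mulr0 add0r.
have [y def_y] := choice q_den.
pose q2 := \poly_(i < size q) y i.
have def_q2 : q2^f = x *: q^f.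
  apply/polyP => i; rewrite coef_map coefZ coef_map coef_poly /=.
  by case: ltnP => [_|le_qi]; [rewrite def_y | rewrite nth_default // rmorph0 mulr0].
have q20 : root_set q2 by rewrite /root_set /= def_q2 hornerZ q0 mulr0.
have [r [def_q _]] := root_factor q0; have [r2 [def_q2' r2_den]] := root_factor q20.
exists r; split=> [|i]; first by rewrite def_p def_q -mulrA.
have def_r2 : r2^f = x *: r^f.
  apply: (mulIf (negbT (polyXsubC_eq0 x))); rewrite -def_q2' def_q2 def_q.
  by rewrite -scalerAl.
have [z def_z] := r2_den i; exists z.
have e : iota r2`_i = x * iota r`_i by rewrite -!(coef_map iota) def_r2 coefZ.
by rewrite -def_z e mulrA.
Qed.

Local Notation den2 := (ideal_mul den_set den_set).
Local Notation root2 := (ideal_mul root_set root_set).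

Lemma den2_coefM (p q : {poly A}) : (forall i, den2 q`_i) -> forall i, den2 (p * q)`_i.
Proof.
move=> qd i; rewrite coefM; elim/big_ind: _ => [|u v|j _]; first exact: in_span0.
  exact: in_spanD.
by apply: (@in_spanZ A A^o _ p`_j q`_(i - j)); exact: qd.
Qed.

Lemma root2_factor p : root2 p -> exists q, p^f = q^f * Xx ^+ 2 /\ forall i, den2 q`_i.
Proof.
elim=> [|c u v [j [k [j0 k0 ->]]] _ [q [def_v q_den]]].
  by exists 0; rewrite !rmorph0 mul0r; split=> // i; rewrite coef0; exact: in_span0.
have [qj [def_j qj_den]] := root_factor j0; have [qk [def_k qk_den]] := root_factor k0.
exists (c * (qj * qk) + q); split=> [|i].
  rewrite rmorphD -[c *: _]/(c * (j * k)) !rmorphM /= def_v def_j def_k rmorphD !rmorphM /=.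
  ring.
rewrite coefD; apply: in_spanD; last exact: q_den.
move: i; apply: den2_coefM => i.
rewrite coefM; elim/big_ind: _ => [|s t|l _]; first exact: in_span0.
  exact: in_spanD.
by apply: in_span_sub; exists qj`_l, qk`_(i - l).
Qed.

(** For c1, c2 in D, c1 c2 (X - x)^2 is the product of c1 X - c1 x and c2 X - c2 x, both in J. *)
Lemma den2_root2 z : den2 z -> exists2 t, root2 t & t^f = (z%:P)^f * Xx ^+ 2.
Proof.
elim=> [|c u v [c1 [c2 [[y1 d1] [y2 d2] ->]]] _ [t t2 def_t]].
  by exists 0; [exact: in_span0 | rewrite !rmorph0 mul0r].
pose l d y : {poly A} := d *: 'X - y%:P.
have lE d y : x * iota d = iota y -> (l d y)^f = (iota d)%:P * Xx.
  move=> e; rewrite /l rmorphB /= map_polyZ map_polyX map_polyC /= -e -mul_polyC polyCM; ring.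
have l0 d y : x * iota d = iota y -> root_set (l d y).
  by move=> /lE e; rewrite /root_set /= e hornerM !hornerE subrr mulr0.
exists (c%:P * (l c1 y1 * l c2 y2) + t).
  apply: (@in_spanD _ {poly A}^o) => //; apply: (@in_spanZ _ {poly A}^o).
  by apply: in_span_sub; exists (l c1 y1), (l c2 y2); split=> //; exact: l0.
rewrite rmorphD !rmorphM /= (lE _ _ d1) (lE _ _ d2) def_t -[c *: _]/(c * (c1 * c2)).
rewrite polyCD !polyCM rmorphD !rmorphM /= (map_polyC _ c1) (map_polyC _ c2) /=.
by move: (c%:P^f) (iota c1)%:P (iota c2)%:P (v%:P^f) Xx => ? ? ? ? ?; ring.
Qed.

Lemma root2_of_factor p q : p^f = q^f * Xx ^+ 2 -> (forall i, den2 q`_i) -> root2 p.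
Proof.
move=> def_p q_den.
suff [t t2 def_t] : exists2 t, root2 t & t^f = q^f * Xx ^+ 2.
  by have <- : t = p by apply: mapf_inj; rewrite def_t def_p.
rewrite -[q]coefK poly_def; elim/big_ind: _ => [|r s [t t2 def_t] [t' t2' def_t']|i _].
- by exists 0; [exact: in_span0 | rewrite !rmorph0 mul0r].
- exists (t + t'); first exact: in_spanD.
  by rewrite !rmorphD /= def_t def_t' mulrDl.
have [t t2 def_t] := den2_root2 (q_den i).
exists ('X^i * t); first exact: (@in_spanZ _ {poly A}^o _ 'X^i t).
by rewrite rmorphM /= def_t -mul_polyC mulrCA mulrA -rmorphM.
Qed.

(** The square of cx is [c * y], so cx is integral over [A]. *)
Lemma den_of_sq c y : x ^+ 2 * iota c = iota y -> den_set c.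
Proof.
move=> def_y; apply: A_closed; exists ('X^2 - (c * y)%:P); first exact: monicXnsubC.
rewrite /root rmorphB /= map_polyXn map_polyC !hornerE /= tofracM -def_y.
by apply/eqP; ring.
Qed.

Lemma double_root_den :
  (forall p, root_set p -> root_set p^`() -> root2 p) <->
  (forall c, (exists y, x ^+ 2 * iota c = iota y) -> den2 c).
Proof.
split=> [dbl c [d def_d]|den p p0 dp0]; last first.
  have [q [def_p q_den]] := double_root_factor p0 dp0.
  by apply: root2_of_factor def_p _ => i; exact: den.
have [y def_y] := den_of_sq def_d.
(* This is c (X - x)^2, whose coefficients c, -2cx and cx^2 lie in [A]. *)
pose p := c *: 'X^2 - (y *+ 2) *: 'X + d%:P.
have def_p : p^f = (c%:P)^f * Xx ^+ 2.
  rewrite /p rmorphD rmorphB /= !map_polyZ map_polyXn map_polyX !map_polyC /=.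
  by rewrite -def_d rmorphMn /= -def_y -!mul_polyC polyCMn !polyCM; ring.
have p0 : root_set p by rewrite /root_set /= def_p hornerM horner_exp hornerXsubC subrr expr0n mulr0.
have dp0 : root_set p^`().
  rewrite /root_set /= -deriv_map def_p expr2 mulrA derivM derivXsubC mulr1.
  by rewrite hornerD !hornerM hornerXsubC subrr !mulr0 addr0.
have [q [def_p' q_den]] := root2_factor (dbl p p0 dp0).
(* The quotient of [p] by (X - x)^2 is unique. *)
have def_q : q = c%:P.
  apply: mapf_inj; apply: (mulIf (expf_neq0 2 (negbT (polyXsubC_eq0 x)))).
  by rewrite -def_p' -def_p.
by have := q_den 0%N; rewrite def_q coefC.
Qed.
End FractionRoot.

(** * Tensor products, and flatness of an intersection of two principal ideals *)

Section TensorTheory.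
Variables (R : comNzRingType) (M N : lmodType R).

Lemma tens0l (n : N) : tens (0 : M) n = 0.
Proof.
have := tensPl 1 (0 : M) 0 n; rewrite !scale1r addr0 => /eqP.
by rewrite addrC -subr_eq subrr eq_sym => /eqP.
Qed.

Lemma tens0r (m : M) : tens m (0 : N) = 0.
Proof.
have := tensPr 1 m (0 : N) 0; rewrite !scale1r addr0 => /eqP.
by rewrite addrC -subr_eq subrr eq_sym => /eqP.
Qed.

Lemma tensZ c (m : M) (n : N) : tens (c *: m) n = tens m (c *: n).
Proof. by rewrite -[c *: m]addr0 -[c *: n]addr0 tensPl tensPr tens0l tens0r. Qed.

Lemma tensD (m m' : M) (n : N) : tens (m + m') n = tens m n + tens m' n.
Proof. by rewrite -[m in LHS]scale1r tensPl scale1r. Qed.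

Lemma tensor_maplE (M' : lmodType R) (f : {linear M -> M'}) (m : M) (n : N) :
  tensor_mapl f (tens m n) = tens (f m) n.
Proof. exact: etrans (quot_liftE _ _) (free_liftU _ _). Qed.
Section Lift.
Variables (W : lmodType R) (h : (M * N)%type -> W).
Hypotheses (hPl : forall c m m' n, h (c *: m + m', n) = c *: h (m, n) + h (m', n))
  (hPr : forall c m n n', h (m, c *: n + n') = c *: h (m, n) + h (m, n')).

Lemma tensor_lift_rel z : tensor_rel z -> free_lift h z = 0.
Proof.
case=> -[c [m [m' [n ->]]]]; rewrite raddfB raddfD /= linearZ /= !free_liftU.
  by rewrite hPl subrr.
by rewrite hPr subrr.
Qed.

Definition tensor_lift : tensor M N -> W := quot_lift tensor_lift_rel.
HB.instance Definition _ := GRing.Linear.on tensor_lift.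

Lemma tensor_liftE m n : tensor_lift (tens m n) = h (m, n).
Proof. exact: etrans (quot_liftE _ _) (free_liftU _ _). Qed.
End Lift.
End TensorTheory.

Section PrincipalInter.
Variables (A : comNzRingType) (a b : A).
Let I := principal a `&` principal b.

Lemma principal_in_span (c z : A) : in_span (principal c : set A^o) z -> principal c z.
Proof.
elim=> [|d u v [u' _ <-] _ [v' _ <-]]; first by exists 0; rewrite ?mulr0.
by exists (d * u' + v'); rewrite // mulrDr mulrCA.
Qed.

Lemma principalI_in_span (z : A) : in_span (I : set A^o) z -> I z.
Proof.
move=> Iz; split; apply: principal_in_span; elim: Iz => [|d u v [ua ub] _ IH];
  by [exact: in_span0 | exact: in_spanZD].
Qed.

Lemma principalI_mul_sub z : ideal_mul I I z -> principal (a ^+ 2) z /\ principal (b ^+ 2) z.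
Proof.
elim=> [|c _ v [u [u' [[[y1 _ <-] [y2 _ def_y2]] [[y3 _ <-] [y4 _ def_y4]] ->]]]
          _ [[va _ <-] [vb _ def_vb]]].
  by split; exists 0; rewrite ?mulr0.
split; first by exists (c * (y1 * y3) + va) => //; rewrite -[c *: _]/(c * _); ring.
exists (c * (y2 * y4) + vb) => //.
by rewrite mulrDr def_vb -def_y2 -def_y4 -[c *: _]/(c * _); ring.
Qed.

Let Ia := quotmod (I : set A^o).
Let Ra := quotmod (principal a : set A^o).
Let Rb := quotmod (principal b : set A^o).

Definition residue2 (r : A^o) : (Ra * Rb)%type := (quot_pi _ r, quot_pi _ r).

Fact residue2_is_linear : linear residue2.
Proof. by move=> c u v; congr (_, _); rewrite linearP. Qed.

HB.instance Definition _ :=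
  GRing.isLinear.Build A A^o (Ra * Rb)%type *:%R residue2 residue2_is_linear.

Fact residue2_I z : I z -> residue2 z = 0.
Proof.
move=> [za zb]; congr (_, _); rewrite -(raddf0 (quot_pi _)); apply/quot_pi_eq;
  by rewrite subr0; exact: in_span_sub.
Qed.

Definition residue_map : Ia -> (Ra * Rb)%type :=
  @quot_lift A A^o I (Ra * Rb)%type residue2 residue2_I.
HB.instance Definition _ := GRing.Linear.on residue_map.

Lemma residue_mapE r : residue_map (quot_pi _ r) = residue2 r.
Proof. exact: quot_liftE. Qed.

Lemma residue_map_inj : injective residue_map.
Proof.
move=> u v; rewrite -[u]quot_reprK -[v]quot_reprK !residue_mapE => -[/quot_pi_eq ea /quot_pi_eq eb].
by apply/quot_pi_eq/in_span_sub; split; exact: principal_in_span.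
Qed.

Let II : set A^o := [set z | exists x y, [/\ I x, I y & z = x * y]].
Let W := quotmod II.
Let h (k : (Ia * ideal_mod I)%type) : W := quot_pi II (quot_repr k.1 * \val k.2).

Lemma ideal_mod_in (m : ideal_mod I) : I (\val m).
Proof. by apply: principalI_in_span; apply/span_predP; exact: (valP m). Qed.

(** Another representative of [n] differs by an element of [I], which changes the product by an
    element of I^2. *)
Lemma quot_repr_congr (r : A) (n : Ia) (m : ideal_mod I) :
  n = quot_pi (I : set A^o) r -> h (n, m) = quot_pi II (r * \val m).
Proof.
move=> def_n; apply/quot_pi_eq; rewrite -mulrBl; apply: in_span_sub.
exists (quot_repr n - r), (\val m); split=> //; last exact: ideal_mod_in.
by apply: principalI_in_span; apply/quot_pi_eq; rewrite quot_reprK.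
Qed.

Fact residue_mulPl c m m' (n : ideal_mod I) :
  h (c *: m + m', n) = c *: h (m, n) + h (m', n).
Proof.
rewrite (@quot_repr_congr (c * quot_repr m + quot_repr m')).
  by rewrite mulrDl -mulrA; exact: linearP.
by rewrite -[c * _]/(c *: (quot_repr m : A^o)) linearP /= !quot_reprK.
Qed.

Fact residue_mulPr c (m : Ia) (n n' : ideal_mod I) :
  h (m, c *: n + n') = c *: h (m, n) + h (m, n').
Proof. by rewrite /h /= mulrDr mulrCA; exact: linearP. Qed.

(** The multiplication from the tensor product of A/I and I to A/I^2; its value at the tensor of 1
    and m tells whether m is in I^2. *)
Definition residue_mul : {linear tensor Ia (ideal_mod I) -> W} :=
  tensor_lift residue_mulPl residue_mulPr.

Lemma residue_mulE r m : residue_mul (tens (quot_pi (I : set A^o) r) m) = quot_pi II (r * \val m).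
Proof.
apply: etrans (tensor_liftE residue_mulPl residue_mulPr _ _) _.
exact: quot_repr_congr.
Qed.
End PrincipalInter.

(** Tensoring [A/I -> A/a * A/b] with the flat ideal [I] shows that [aI] and [bI] meet
    inside [I * I]. *)
Lemma flat_principalI (A : comNzRingType) (a b u v : A) (I := principal a `&` principal b) :
  flat (ideal_mod I) -> I u -> I v -> a * u = b * v -> ideal_mul I I (a * u).
Proof.
move=> flatI Iu Iv eq_uv.
have inI z : I z -> z \in span_pred (I : set A^o) by move=> Iz; apply/span_predP/in_span_sub.
pose mu : ideal_mod I := Sub u (inI u Iu); pose mv : ideal_mod I := Sub v (inI v Iv).
have eq_m : a *: mu = b *: mv by apply: val_inj.
have tens_au : tens (quot_pi (I : set A^o) (1 : A^o)) (a *: mu) = 0.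
  have inj_f := flatI _ _ _ (@residue_map_inj _ a b).
  apply: inj_f.
  rewrite raddf0 tensor_maplE [X in tens X _]residue_mapE.
  (* Since [a *: mu = b *: mv], the tensor with (1, 0) can be written with the scalar [a] on the
     left, the one with (0, 1) with the scalar [b]; both then vanish. *)
  have -> : residue2 a b 1 = (quot_pi _ (1 : A^o), 0) + (0, quot_pi _ (1 : A^o)).
    by congr (_, _); rewrite ?addr0 ?add0r.
  rewrite tensD -tensZ eq_m -tensZ.
  have pi0 c : c *: quot_pi (principal c : set A^o) (1 : A^o) = 0.
    rewrite -linearZ -(raddf0 (quot_pi _)); apply/quot_pi_eq/in_span_sub.
    by exists 1; rewrite ?subr0.
  have -> : a *: (quot_pi (principal a : set A^o) (1 : A^o), 0)
      = 0 :> (quotmod (principal a : set A^o) * quotmod (principal b : set A^o))%type.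
    by congr (_, _); rewrite ?scaler0 ?pi0.
  have -> : b *: (0, quot_pi (principal b : set A^o) (1 : A^o))
      = 0 :> (quotmod (principal a : set A^o) * quotmod (principal b : set A^o))%type.
    by congr (_, _); rewrite ?scaler0 ?pi0.
  by rewrite !tens0l addr0.
have := residue_mulE (a := a) (b := b) 1 (a *: mu); rewrite tens_au raddf0 mul1r => /esym.
by rewrite -(raddf0 (quot_pi _)) => /quot_pi_eq; rewrite subr0.
Qed.

(** * From denominators of a/b to ideals of A *)

Section FractionIdeals.
Variables (A : idomainType) (A_closed : integrally_closed A) (a b : A).
Hypotheses (a_neq0 : a != 0) (b_neq0 : b != 0).
Local Notation iota := (@tofrac A).
Let x : {fraction A} := iota a / iota b.
Let I := principal a `&` principal b.

Lemma frac_expE n c y : x ^+ n * iota c = iota y <-> a ^+ n * c = b ^+ n * y.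
Proof.
have bn0 : iota (b ^+ n) != 0 by rewrite tofrac_eq0 expf_neq0.
have -> : x ^+ n * iota c = iota (a ^+ n * c) / iota (b ^+ n).
  by rewrite /x expr_div_n -!tofracXn mulrAC -tofracM.
split=> [e|->]; last by rewrite [in LHS]tofracM mulrAC divff ?mul1r.
by apply: (@tofrac_inj A); rewrite [RHS]tofracM -e [RHS]mulrC divfK.
Qed.

Lemma den_setE c : den_set x c <-> I (a * c).
Proof.
split=> [[y]|[_ [y _ e]]].
  by rewrite -[x]expr1 => /frac_expE; rewrite !expr1 => e; split; [exists c | exists y].
by exists y; rewrite -[x]expr1; apply/frac_expE; rewrite !expr1.
Qed.

Lemma principal_sqI z : principal (a ^+ 2) z /\ principal (b ^+ 2) z <->
  exists2 c, z = a ^+ 2 * c & exists y, x ^+ 2 * iota c = iota y.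
Proof.
split=> [[[c _ <-] [y _ e]]|[c -> [y /frac_expE e]]].
  by exists c => //; exists y; apply/frac_expE.
by split; [exists c | exists y].
Qed.

(** By [den_setE], I = aD, so I^2 = a^2 D^2, and a^2 can be cancelled. *)
Lemma ideal_mul_denE c :
  ideal_mul I I (a ^+ 2 * c) <-> ideal_mul (den_set x) (den_set x) c.
Proof.
split.
  suff H z : ideal_mul I I z -> exists2 c', z = a ^+ 2 * c' &
      ideal_mul (den_set x) (den_set x) c'.
    by move=> /H[c' /(mulfI (expf_neq0 2 a_neq0)) ->].
  elim=> [|d _ v [_ [_ [[[c1 _ <-] I1] [[c2 _ <-] I2] ->]]] _ [c' -> c'_den]].
    by exists 0; [rewrite mulr0 | exact: in_span0].
  exists (d * (c1 * c2) + c'); first by rewrite -[d *: _]/(d * _); ring.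
  apply: in_spanZD c'_den; exists c1, c2.
  by split=> //; apply/den_setE; split=> //; [exists c1 | exists c2].
elim=> [|d _ v [c1 [c2 [/den_setE I1 /den_setE I2 ->]]] _ IH].
  by rewrite mulr0; exact: in_span0.
have -> : a ^+ 2 * (d *: (c1 * c2 : A^o) + v) = d *: (a * c1 * (a * c2) : A^o) + a ^+ 2 * v.
  by rewrite -![d *: _]/(d * _); ring.
by apply: in_spanZD IH; exists (a * c1), (a * c2).
Qed.

Lemma principal_sqIE :
  principal (a ^+ 2) `&` principal (b ^+ 2) = ideal_mul I I <->
  (forall c, (exists y, x ^+ 2 * iota c = iota y) -> ideal_mul (den_set x) (den_set x) c).
Proof.
split=> [eq_I c c2|den].
  apply/ideal_mul_denE; rewrite -eq_I; apply/principal_sqI; by exists c.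
apply/seteqP; split=> z; last exact: principalI_mul_sub.
by move/principal_sqI => [c -> c2]; apply/ideal_mul_denE; exact: den.
Qed.

Lemma flat_principal_sqI : flat (ideal_mod I) ->
  principal (a ^+ 2) `&` principal (b ^+ 2) = ideal_mul I I.
Proof.
move=> flatI; apply/principal_sqIE => c [d def_d].
have /den_setE Iac := den_of_sq A_closed def_d.
have [_ [y _ def_y]] := Iac; move/frac_expE: def_d => def_d.
(* Cancel b in b(ay) = a(ac) = b^2 d. Then [a * y] lies in [I] and a(ac) = b(ay), as
   [flat_principalI] requires. *)
have ay : a * y = b * d.
  by apply: (mulfI b_neq0); rewrite mulrCA def_y !mulrA -!expr2.
have Iay : I (a * y) by split; [exists y | exists d].
apply/ideal_mul_denE; rewrite expr2 -mulrA; apply: flat_principalI flatI Iac Iay _.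
by rewrite -def_y; ring.
Qed.
End FractionIdeals.

(** * The algebra A[x], and the conclusion for x = a/b *)

Section AdjoinEval.
Variables (A : idomainType) (x : {fraction A}).

Lemma adjoin_gen_in : x \in adjoin_pred x.
Proof. by apply/adjoin_predP; exists 'X; rewrite map_polyX hornerX. Qed.

Definition adjoin_gen : adjoin x := Sub x adjoin_gen_in.

Lemma val_evalX p :
  \val (evalX (@adjoin_str A x) adjoin_gen p) = (map_poly (@tofrac A) p).[x].
Proof.
pose u : {rmorphism {poly A} -> {fraction A}} :=
  \val \o evalX (@adjoin_str A x) adjoin_gen.
pose v : {rmorphism {poly A} -> {fraction A}} := horner_eval x \o map_poly (@tofrac A).
apply: (poly_rmorph_ext (u := u) (v := v)) => [c|]; rewrite /= /horner_eval.
  by rewrite !map_polyC !hornerC.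
by rewrite !map_polyX !hornerX.
Qed.

Lemma ker_evalX : ker_set (evalX (@adjoin_str A x) adjoin_gen) = root_set x.
Proof.
apply/seteqP; split=> p; rewrite /ker_set /root_set /= => p0.
  by rewrite -val_evalX; exact: (congr1 val p0).
by apply: val_inj; rewrite val_evalX.
Qed.

Lemma evalX_section :
  exists sec, cancel sec (evalX (@adjoin_str A x) adjoin_gen).
Proof.
have /choice[sec secK] (y : adjoin x) :
    exists p, evalX (@adjoin_str A x) adjoin_gen p = y.
  have /adjoin_predP[p def_y] := valP y.
  by exists p; apply: val_inj; rewrite val_evalX.
by exists sec.
Qed.

Lemma AQ1_adjoin_eq0 :
  (forall h : AQ (@adjoin_str A x : {rmorphism A -> adjoin x}) (adjoin x)^o 1, h = 0) <->
  (forall p, root_set x p -> root_set x p^`() ->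
     ideal_mul (root_set x) (root_set x) p).
Proof.
have [sec secK] := evalX_section; rewrite (AQ1_eq0 secK) ker_evalX.
have rootE p : evalX (@adjoin_str A x) adjoin_gen p = 0 <-> root_set x p.
  by rewrite -ker_evalX.
by split=> H p /rootE p0 /rootE dp0; exact: H.
Qed.
End AdjoinEval.

Theorem corollary1p5 (A : idomainType) (A_closed : integrally_closed A)
    (a b : A) (a_neq0 : a != 0) (b_neq0 : b != 0) :
  let B := adjoin (tofrac a / tofrac b) in
  let f : {rmorphism A -> B} := @adjoin_str A (tofrac a / tofrac b) in
  let I := principal a `&` principal b in
  ((forall h : AQ f B^o 1, h = 0) <->
     principal (a ^+ 2) `&` principal (b ^+ 2) = ideal_mul I I)
  /\ (flat (ideal_mod I) -> forall h : AQ f B^o 1, h = 0).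
Proof.
move=> B f I.
have AQ_iff : (forall h : AQ f B^o 1, h = 0) <->
    principal (a ^+ 2) `&` principal (b ^+ 2) = ideal_mul I I.
  rewrite AQ1_adjoin_eq0 (double_root_den A_closed).
  exact: iff_sym (principal_sqIE a_neq0 b_neq0).
by split=> // flatI; apply/AQ_iff; exact: flat_principal_sqI.
Qed.
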